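(* (i) Let $U\subseteq\mathbb{R}^n$ be r.e. open, $f:U\to\mathbb{R}^m$ computable and continuously differentiable with computable derivative, and $\vec x_0\in U$ computable with $\operatorname{rank}f'(\vec x_0)=m$. Then there exist a rational $\delta>0$ and a computable, continuously differentiable function $g:B(f(\vec x_0),\delta)\to U$ with computable derivative such that $g(f(\vec x_0))=\vec x_0$ and $f(g(\vec y))=\vec y$ for all $\vec y\in B(f(\vec x_0),\delta)$. (ii) Moreover, let $X\subseteq\mathbb{R}^n$ be r.e. open and $f:X\to\mathbb{R}^m$ computable and continuously differentiable with computable derivative $f':X\to\mathbb{R}^{m\times n}$. Then the multi-valued mapping $I:\mathfrak{O}^n\times X\rightrightarrows\mathbb{N}$ whose graph is the set of $(U,\vec x_0,k)$ such that $\vec x_0\in U\subseteq X$ with $U$ open, $\operatorname{rank}f'(\vec x_0)=m$, and there exists $g:B(f(\vec x_0),2^{-k})\to U$ with $g(f(\vec x_0))=\vec x_0$ and $f(g(\vec y))=\vec y$ for all $\vec y\in B(f(\vec x_0),2^{-k})$, is $(\theta^n_<\times\rho^n\rightrightarrows\nu)$-computable.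
   Context: Type-2 computability (Weihrauch). $\rho^n$: Cauchy representation of $\mathbb{R}^n$; $\nu$: standard notation of $\mathbb{N}$; $\mathfrak{O}^n$: open subsets of $\mathbb{R}^n$, represented by $\theta^n_<$ (a name lists rational centers and radii of open balls with union the set). r.e. open: has a computable $\theta^n_<$-name. A multi-valued $h:A\rightrightarrows\mathbb{N}$ is computable if a machine, given any names of the inputs in the domain, outputs some element of $h$ of the inputs. $B(\vec y,r)$: open Euclidean ball. *)

(* Defs.v *)
From HB Require Import structures.
From mathcomp Require Import all_boot all_order all_algebra.
From mathcomp Require Import all_classical all_reals all_analysis.

Set Implicit Arguments.
Unset Strict Implicit.
Unset Printing Implicit Defensive.

Import Order.TTheory GRing.Theory Num.Theory.
Import numFieldNormedType.Exports.
Local Open Scope classical_set_scope.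
Local Open Scope ring_scope.

Inductive prf : Type :=
| PZero
| PSucc
| PProj of nat
| POracle
| PComp of prf & list prf
| PRec of prf & prf
| PMin of prf.

Inductive eval (o : nat -> nat) : prf -> seq nat -> nat -> Prop :=
| eZero v : eval o PZero v 0
| eSucc v : eval o PSucc v (head 0%N v).+1
| eProj i v : eval o (PProj i) v (nth 0%N v i)
| eOracle v : eval o POracle v (o (head 0%N v))
| eComp f gs v ws r :
    evals o gs v ws -> eval o f ws r -> eval o (PComp f gs) v r
| eRec0 f g v r : eval o f v r -> eval o (PRec f g) (0%N :: v) r
| eRecS f g n v r r' :
    eval o (PRec f g) (n :: v) r -> eval o g (n :: r :: v) r' ->
    eval o (PRec f g) (n.+1 :: v) r'
| eMin f v n :
    eval o f (n :: v) 0 ->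
    (forall k, (k < n)%N -> exists r, eval o f (k :: v) r.+1) ->
    eval o (PMin f) v n
with evals (o : nat -> nat) : list prf -> seq nat -> seq nat -> Prop :=
| esNil v : evals o nil v nil
| esCons g gs v w ws :
    eval o g v w -> evals o gs v ws -> evals o (g :: gs) v (w :: ws).

Definition computes (c : prf) (o q : nat -> nat) : Prop :=
  forall k, eval o c [:: k] (q k).

Definition computable_seq (p : nat -> nat) : Prop :=
  exists c, computes c (fun _ => 0%N) p.

Definition pair_name (p q : nat -> nat) : nat -> nat :=
  fun k => if odd k then q k./2 else p k./2.

Definition cpair (a b : nat) : nat := ('C(a + b + 1, 2) + b)%N.

Fixpoint cunpair (n : nat) : nat * nat :=
  match n with
  | 0 => (0, 0)
  | n'.+1 => let (a, b) := cunpair n' in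
             match a with
             | 0 => (b.+1, 0)
             | a'.+1 => (a', b.+1)
             end
  end%N.

Definition zdec (a : nat) : int :=
  if odd a then - (a./2.+1)%:Z else (a./2)%:Z.

(* nu_Q : nat -> Q, surjective; valued in R *)
Definition qdec {R : realType} (n : nat) : R :=
  let (a, b) := cunpair n in (zdec a)%:~R / (b.+1)%:R.

Definition rhoM {R : realType} (m n : nat) (p : nat -> nat) (A : 'M[R]_(m, n)) : Prop :=
  forall (k : nat) (i : 'I_m) (j : 'I_n),
    `| A i j - qdec (p (cpair k (cpair i j))) | <= 2 ^- k.

Definition rho {R : realType} (n : nat) (p : nat -> nat) (x : 'rV[R]_n) : Prop :=
  rhoM p x.

Definition computable_vec {R : realType} (n : nat) (x : 'rV[R]_n) : Prop :=
  exists p, rho p x /\ computable_seq p.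

Definition enorm {R : realType} (n : nat) (v : 'rV[R]_n) : R :=
  Num.sqrt (\sum_(i < n) v ord0 i ^+ 2).

Definition eball {R : realType} (n : nat) (c : 'rV[R]_n) (r : R) : set 'rV[R]_n :=
  [set y | enorm (y - c) < r].

(* The j-th entry of a theta_<-name p lists the ball with rational radius
   qdec (p (cpair j 0)) and center coordinates qdec (p (cpair j i.+1));
   a non-positive radius gives the empty ball (= "no ball listed"). *)
Definition name_center {R : realType} (n : nat) (p : nat -> nat) (j : nat) : 'rV[R]_n :=
  \row_(i < n) qdec (p (cpair j i.+1)).
Arguments name_center {R n} p j.

Definition theta {R : realType} (n : nat) (p : nat -> nat) (U : set 'rV[R]_n) : Prop :=
  U = \bigcup_(j in [set: nat]) eball (name_center p j) (qdec (p (cpair j 0))).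

Definition re_open {R : realType} (n : nat) (U : set 'rV[R]_n) : Prop :=
  exists p, theta p U /\ computable_seq p.

Definition computable_on {R : realType} (n m k : nat) (D : set 'rV[R]_n)
    (f : 'rV[R]_n -> 'M[R]_(m, k)) : Prop :=
  exists c : prf, forall x, D x -> forall p, rho p x ->
    exists q, computes c p q /\ rhoM q (f x).

(* Df is the (continuous) derivative of f on the open set D:
   f'(x) is the m x n Jacobian matrix acting on column vectors. *)
Definition C1_with_derivative {R : realType} (n m : nat) (D : set 'rV[R]_n)
    (f : 'rV[R]_n -> 'rV[R]_m) (Df : 'rV[R]_n -> 'M[R]_(m, n)) : Prop :=
  forall x, D x ->
    [/\ differentiable f x,
        (forall h : 'rV[R]_n, 'd f x h = (Df x *m h^T)^T)
      & {for x, continuous Df}].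

Definition I_graph {R : realType} (n m : nat) (X : set 'rV[R]_n)
    (f : 'rV[R]_n -> 'rV[R]_m) (Df : 'rV[R]_n -> 'M[R]_(m, n))
    (U : set 'rV[R]_n) (x0 : 'rV[R]_n) (k : nat) : Prop :=
  [/\ U x0, U `<=` X, open U, \rank (Df x0) = m &
      exists g : 'rV[R]_m -> 'rV[R]_n,
        [/\ forall y, eball (f x0) (2 ^- k) y -> U (g y),
            g (f x0) = x0 &
            forall y, eball (f x0) (2 ^- k) y -> f (g y) = y]].

(* (theta^n_< x rho^n =>> nu)-computability of a multi-valued map
   O^n x R^n =>> N given by its graph G: the machine reads the paired
   names and halts with output k (computed at argument 0). *)
Definition mv_computable {R : realType} (n : nat)
    (G : set 'rV[R]_n -> 'rV[R]_n -> nat -> Prop) : Prop :=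
  exists c : prf, forall (U : set 'rV[R]_n) (x : 'rV[R]_n),
    (exists k, G U x k) ->
    forall pU px, theta pU U -> rho px x ->
      exists k, eval (pair_name pU px) c [:: 0%N] k /\ G U x k.

(* Main.v *)
(* Choose a rational matrix W with W f'(x0)^T close to the identity.  On a small
   cube the slice map F(t) = f(x0 + t W) satisfies
   |F(t) - F(t') - (t - t')| <= |t - t'| / 2, so F is injective with a Lipschitz
   inverse, and it covers a ball around f(x0): a minimiser t of |F(t) - y| has
   F(t) = y, because t - (F(t) - y) would otherwise do better.

   (i) A rational t with F(t) within 2^-(a+1) of y is within 2^-a of F^-1(y), so
   F^-1(y) is computed by searching for such t.  The derivative of
   g = x0 + F^-1(y) W is the transpose of J^-1 W with J = W f'(g(y))^T, and J^-1
   is approximated by searching for a rational M with M J close to 1.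

   (ii) A terminating run of the machine for f' reads finitely many entries of
   the name of x0, and the number of entries read is itself computable.  Fed with
   a name whose entries are valid with a margin, the machine gives the same
   output near x0, which is an effective modulus of continuity of f' at x0.  The
   existence of W, of a ball around x0 inside U and of the radius 2^-k then become
   a decidable certificate, and the machine searches for it. *)

From Pilot Require Import Defs.
From HB Require Import structures.
From mathcomp Require Import all_boot all_order all_algebra.
From mathcomp Require Import all_classical all_reals all_analysis.
From mathcomp Require Import zify ring lra.
Import Order.TTheory GRing.Theory Num.Theory.
Import numFieldNormedType.Exports.
(* [eval] is also a notation of MathComp-Analysis. *)
Import Pilot.Defs.
Local Open Scope classical_set_scope.
Local Open Scope ring_scope.

Set Implicit Arguments.
Unset Strict Implicit.
Unset Printing Implicit Defensive.

(** * Oracle programs *)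

(** Fixing [n - m] coordinates of [x0] would also reduce the problem to a square one, but requires
    the choice of an invertible minor of [f'(x0)]. A rational [W] close to a transposed right
    inverse replaces that choice, and since its fitness is an open condition, finitely many digits
    can confirm it. Closeness to the identity is measured entrywise by [1 / (2 (m + 1))], which
    keeps column sums below 1/2, the contraction constant in the sup norm. The Euclidean norm enters
    only through the balls of the statement.

    In (i) the matrix, the cube and the program for [x0] are constants built into one machine, so
    their existence suffices. In (ii) they vary with the input and have to be recognised. The
    obstacle is that digits of [f'(x0)] alone say nothing about [f'] at neighbouring points. Every
    condition on reals is therefore replaced by a rational test with explicit error terms, arranged
    so that a passed test is a proof and some candidate always passes. *)

Section EvalInduction.
Variable o : nat -> nat.
Variables (Q : prf -> seq nat -> nat -> Prop)
  (Qs : seq prf -> seq nat -> seq nat -> Prop).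
Hypothesis HZero : forall v, Q PZero v 0.
Hypothesis HSucc : forall v, Q PSucc v (head 0%N v).+1.
Hypothesis HProj : forall i v, Q (PProj i) v (nth 0%N v i).
Hypothesis HOracle : forall v, Q POracle v (o (head 0%N v)).
Hypothesis HComp : forall f gs v ws r, evals o gs v ws -> Qs gs v ws ->
  eval o f ws r -> Q f ws r -> Q (PComp f gs) v r.
Hypothesis HRec0 : forall f g v r, eval o f v r -> Q f v r ->
  Q (PRec f g) (0%N :: v) r.
Hypothesis HRecS : forall f g n v r r',
  eval o (PRec f g) (n :: v) r -> Q (PRec f g) (n :: v) r ->
  eval o g (n :: r :: v) r' -> Q g (n :: r :: v) r' ->
  Q (PRec f g) (n.+1 :: v) r'.
Hypothesis HMin : forall f v n, eval o f (n :: v) 0 -> Q f (n :: v) 0 ->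
  (forall k, (k < n)%N ->
     exists r, eval o f (k :: v) r.+1 /\ Q f (k :: v) r.+1) ->
  Q (PMin f) v n.
Hypothesis HNil : forall v, Qs nil v nil.
Hypothesis HCons : forall g gs v w ws, eval o g v w -> Q g v w ->
  evals o gs v ws -> Qs gs v ws -> Qs (g :: gs) v (w :: ws).

(** In [eMin] the evaluations below the minimum sit under an existential; matching on it inside the
    recursion yields an induction hypothesis for them as well. *)
Fixpoint eval_strong_ind c v r (H : eval o c v r) {struct H} : Q c v r :=
  match H in eval _ c v r return Q c v r with
  | eZero v => HZero v
  | eSucc v => HSucc v
  | eProj i v => HProj i v
  | eOracle v => HOracle v
  | eComp f gs v ws r hs hf =>
      HComp hs (evals_strong_ind hs) hf (eval_strong_ind hf)
  | eRec0 f g v r h => HRec0 g h (eval_strong_ind h)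
  | eRecS f g n v r r' h1 h2 =>
      HRecS h1 (eval_strong_ind h1) h2 (eval_strong_ind h2)
  | eMin f v n h0 hk =>
      HMin h0 (eval_strong_ind h0) (fun k lt =>
        match hk k lt with
        | ex_intro r h => ex_intro _ r (conj h (eval_strong_ind h))
        end)
  end
with evals_strong_ind cs v ws (H : evals o cs v ws) {struct H} : Qs cs v ws :=
  match H in evals _ cs v ws return Qs cs v ws with
  | esNil v => HNil v
  | esCons g gs v w ws h hs =>
      HCons h (eval_strong_ind h) hs (evals_strong_ind hs)
  end.
End EvalInduction.

Lemma eval_det o c v r r' : eval o c v r -> eval o c v r' -> r = r'.
Proof.
move=> H; move: r'.
apply: (@eval_strong_ind o (fun c v r => forall r', eval o c v r' -> r = r')
  (fun cs v ws => forall ws', evals o cs v ws' -> ws = ws') _ _ _ _ _ _ _ _ _ _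
  c v r H).
- by move=> w r' h; inversion h.
- by move=> w r' h; inversion h.
- by move=> i w r' h; inversion h.
- by move=> w r' h; inversion h.
- move=> f gs w ws s _ IH1 _ IH2 r' h; inversion h as [| | | |? ? ? ? ? hs hf| | |]; subst.
  by rewrite -(IH1 _ hs) in hf; apply: IH2.
- by move=> f g w s _ IH r' h; inversion h; subst; apply: IH.
- move=> f g n w s s' _ IH1 _ IH2 r' h; inversion h as [| | | | | |? ? ? ? ? ? hr hg|]; subst.
  by rewrite -(IH1 _ hr) in hg; apply: IH2.
- move=> f w n _ IH0 IHk r' h; inversion h as [| | | | | | |? ? ? h0 hk]; subst.
  have [lt|lt|//] := ltngtP n r'.
    by have [s hs] := hk _ lt; have := IH0 _ hs.
  have [s [_ hs]] := IHk _ lt.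
  by have := hs _ h0.
- by move=> w ws' h; inversion h.
- move=> g gs w x ws _ IH1 _ IH2 ws' h; inversion h as [|? ? ? ? ? hg hs]; subst.
  by rewrite (IH1 _ hg) (IH2 _ hs).
Qed.

(** Divergence is mapped to the junk value 0, so that results of programs can be handled as a total
    function. *)
Definition run o c v : nat := xget 0%N [set r | eval o c v r].

Lemma run_eval o c v r : eval o c v r -> run o c v = r.
Proof.
by move=> h; apply: (eval_det (c := c) (o := o) (v := v)) => //;
  rewrite /run; case: xgetP => // /(_ r) /(_ h).
Qed.

Lemma eval_run o c v : (exists r, eval o c v r) -> eval o c v (run o c v).
Proof. by move=> [r h]; rewrite (run_eval h). Qed.

Definition projs i k := [seq PProj j | j <- iota i k].

Lemma evals_cat o gs gs' v ws ws' : evals o gs v ws -> evals o gs' v ws' ->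
  evals o (gs ++ gs') v (ws ++ ws').
Proof.
elim: gs ws => [|g gs IH] ws h h'; first by inversion h.
by inversion h; subst; apply: esCons => //; apply: IH.
Qed.

Lemma evals_projs o (u w x : seq nat) :
  evals o (projs (size u) (size w)) (u ++ w ++ x) w.
Proof.
elim: w u => [|a w IH] u; first exact: esNil.
apply: esCons.
  suff {2}-> : a = nth 0%N (u ++ (a :: w) ++ x) (size u) by exact: eProj.
  by rewrite nth_cat ltnn subnn.
by have := IH (rcons u a); rewrite size_rcons cat_rcons.
Qed.

Lemma evals_size o gs v ws : evals o gs v ws -> size ws = size gs.
Proof.
elim: gs ws => [|g gs IH] ws h; inversion h as [|? ? ? ? ? hg hs]; subst => //=.
by rewrite (IH _ hs).
Qed.

(* The parameters [w] are kept behind the [k] original arguments, so that the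
   arguments pushed by [PRec] and [PMin] stay in front. *)
Fixpoint subst_oracle (d : prf) (s k : nat) (c : prf) {struct c} : prf :=
  match c with
  | PZero => PZero
  | PSucc => if k is 0 then PComp PSucc [:: PZero] else PSucc
  | PProj i => if (i < k)%N then PProj i else PZero
  | POracle => PComp d ((if k is 0 then PZero else PProj 0) :: projs k s)
  | PComp f gs => PComp (subst_oracle d s (size gs) f)
                    ([seq subst_oracle d s k g | g <- gs] ++ projs k s)
  | PRec f g => PRec (subst_oracle d s k.-1 f) (subst_oracle d s k.+1 g)
  | PMin f => PMin (subst_oracle d s k.+1 f)
  end.

(** Composition of machines: if [d] computes the oracle [o'] from [o] and the parameters [w], a
    program for [o'] becomes one for [o]. *)
Lemma eval_subst_oracle o o' d w c v r :
  (forall k, eval o d (k :: w) (o' k)) -> eval o' c v r ->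
  eval o (subst_oracle d (size w) (size v) c) (v ++ w) r.
Proof.
move=> Hd H.
have projw u : evals o (projs (size u) (size w)) (u ++ w) w.
  by have := evals_projs o u w [::]; rewrite cats0.
apply: (@eval_strong_ind o'
  (fun c v r => eval o (subst_oracle d (size w) (size v) c) (v ++ w) r)
  (fun cs v ws => evals o [seq subst_oracle d (size w) (size v) c | c <- cs]
     (v ++ w) ws) _ _ _ _ _ _ _ _ _ _ c v r H) => {c v r H} /=.
- by move=> v; apply: eZero.
(* Without arguments [PSucc] reads the default 0, which must not turn into the first parameter.
   Projections beyond the original arguments and [POracle] need the same guard. *)
- move=> [|a v] /=; last exact: (eSucc o (a :: v ++ w)).
  by apply: eComp; [apply: esCons; [apply: eZero|apply: esNil]|apply: eSucc].
- move=> i v; case: ltnP => h.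
    have := eProj o i (v ++ w).
    by rewrite nth_cat h.
  by rewrite nth_default //; apply: eZero.
- move=> v; apply: eComp (Hd _); apply: esCons (projw v).
  by case: v => [|a v] /=; [apply: eZero|apply: (eProj o 0 (a :: v ++ w))].
- move=> f gs v ws r h IHs hf IHf.
  apply: eComp; first exact: evals_cat IHs (projw v).
  by rewrite -(evals_size h).
- by move=> f g v r h IH; apply: eRec0.
- by move=> f g n v r r' h IH h' IH'; apply: eRecS IH'.
- move=> f v n h IH hk; apply: eMin => // k /hk [r [_ IHk]]; by exists r.
- by move=> v; apply: esNil.
- by move=> g gs v x ws h IH hs IHs; apply: esCons.
Qed.

Definition p_add := PRec (PProj 0) (PComp PSucc [:: PProj 1]).

Lemma eval_add o a b : eval o p_add [:: a; b] (a + b)%N.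
Proof.
elim: a => [|a IH]; first exact: eRec0 (eProj o 0 [:: b]).
apply: eRecS IH _; apply: eComp; first (apply: esCons; [|exact: esNil]).
  exact: (eProj o 1 [:: a; (a + b)%N; b]).
exact: eSucc.
Qed.

Lemma eval_add_comp o f g v a b : eval o f v a -> eval o g v b ->
  eval o (PComp p_add [:: f; g]) v (a + b)%N.
Proof.
move=> h1 h2; apply: eComp (eval_add o a b).
by do 2 apply: esCons => //; apply: esNil.
Qed.

(* [query_bound k c] computes a strict upper bound for the oracle positions
   that [c] reads on [k] arguments. *)
Fixpoint query_bound (k : nat) (c : prf) {struct c} : prf :=
  match c with
  | PZero | PSucc | PProj _ => PZero
  | POracle => PSucc
  | PComp f gs => PComp p_add [:: PComp (query_bound (size gs) f) gs;
      foldr (fun g acc => PComp p_add [:: query_bound k g; acc]) PZero gs]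
  | PRec f g => PRec (query_bound k.-1 f)
      (PComp p_add [:: PProj 1; PComp (query_bound k.+1 g)
         (PProj 0 :: PComp (PRec f g) (PProj 0 :: projs 2 k.-1)
            :: projs 2 k.-1)])
  | PMin f => PComp
      (PRec (PComp (query_bound k.+1 f) (PZero :: projs 0 k))
        (PComp p_add [:: PProj 1; PComp (query_bound k.+1 f)
           (PComp PSucc [:: PProj 0] :: projs 2 k)]))
      (PMin f :: projs 0 k)
  end.

Definition agree (u : nat) (o o' : nat -> nat) :=
  forall i, (i < u)%N -> o' i = o i.

Lemma agree_addl a b o o' : agree (a + b) o o' -> agree a o o'.
Proof. by move=> h i lt; apply: h; lia. Qed.

Lemma agree_addr a b o o' : agree (a + b) o o' -> agree b o o'.
Proof. by move=> h i lt; apply: h; lia. Qed.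

(** The bound repeats the computation of [c] and adds up the bounds of all subcomputations. Sums
    rather than maxima suffice, since [agree] passes from a sum to each summand. *)
Lemma eval_query_bound o c v r : eval o c v r ->
  exists u, eval o (query_bound (size v) c) v u /\
    forall o', agree u o o' -> eval o' c v r.
Proof.
move=> H.
have proj0 w : evals o (projs 0 (size w)) w w.
  by have := evals_projs o [::] w [::]; rewrite cats0.
have proj2 a b w : evals o (projs 2 (size w)) [:: a, b & w] w.
  by have := evals_projs o [:: a; b] w [::]; rewrite cats0.
apply: (@eval_strong_ind o
  (fun c v r => exists u, eval o (query_bound (size v) c) v u /\
    forall o', agree u o o' -> eval o' c v r)
  (fun cs v ws => exists u, eval o (foldr (fun g acc =>
       PComp p_add [:: query_bound (size v) g; acc]) PZero cs) v u /\
    forall o', agree u o o' -> evals o' cs v ws)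
  _ _ _ _ _ _ _ _ _ _ c v r H) => {c v r H} /=.
- by move=> v; exists 0%N; split; [exact: eZero|move=> o' _; exact: eZero].
- by move=> v; exists 0%N; split; [exact: eZero|move=> o' _; exact: eSucc].
- by move=> i v; exists 0%N; split; [exact: eZero|move=> o' _; exact: eProj].
- move=> v; exists (head 0%N v).+1; split; first exact: eSucc.
  by move=> o' h; rewrite -(h _ (ltnSn _)); apply: eOracle.
- move=> f gs v ws r hs [u2 [hu2 hs']] hf [u1 [hu1 hf']].
  exists (u1 + u2)%N; split.
    apply: eval_add_comp hu2; apply: (eComp hs).
    by rewrite -(evals_size hs).
  by move=> o' h; apply: eComp (hs' _ (agree_addr h)) (hf' _ (agree_addl h)).
- move=> f g v r h [u [hu IH]]; exists u; split; first exact: eRec0.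
  by move=> o' a; apply: eRec0; apply: IH.
- move=> f g n v r r' h [u [hu IH]] h' [u' [hu' IH']].
  exists (u + u')%N; split.
    apply: eRecS hu _; apply: eval_add_comp.
      exact: (eProj o 1 [:: n, u & v]).
    apply: eComp hu'; apply: esCons; first exact: (eProj o 0 [:: n, u & v]).
    apply: esCons (proj2 _ _ _); apply: eComp h.
    by apply: esCons (proj2 _ _ _); exact: (eProj o 0 [:: n, u & v]).
  by move=> o' a; apply: eRecS (IH _ (agree_addl a)) (IH' _ (agree_addr a)).
- move=> f v n h0 IH0 hk.
  (* A minimisation depends on all its tests up to [n], so their bounds are accumulated by recursion
     on [N]; what has to survive a change of oracle is that the first zero is at [n]. *)
  have key : forall N, (N <= n)%N -> exists u,
      eval o (PRec (PComp (query_bound (size v).+1 f) (PZero :: projs 0 (size v)))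
        (PComp p_add [:: PProj 1; PComp (query_bound (size v).+1 f)
           (PComp PSucc [:: PProj 0] :: projs 2 (size v))])) (N :: v) u /\
      forall o', agree u o o' -> forall k, (k <= N)%N ->
        exists r, eval o' f (k :: v) r /\ (r == 0%N) = (k == n).
    have one k : (k <= n)%N -> exists u,
        eval o (query_bound (size v).+1 f) (k :: v) u /\
        forall o', agree u o o' ->
        exists r, eval o' f (k :: v) r /\ (r == 0%N) = (k == n).
      rewrite leq_eqVlt => /orP[/eqP ->|lt].
        case: IH0 => u [hu IH]; exists u; split=> // o' a.
        by exists 0%N; split; [apply: IH|rewrite !eqxx].
      have [r [_ [u [hu IH]]]] := hk _ lt; exists u; split => // o' a.
      by exists r.+1; split; [apply: IH|rewrite (ltn_eqF lt)].
    elim=> [|N IHN] le.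
      have [u [hu hu']] := one 0%N le.
      exists u; split; last by move=> o' a k; rewrite leqn0 => /eqP ->; apply: hu'.
      apply: eRec0; apply: eComp hu; apply: esCons (proj0 _).
      exact: eZero.
    have [u [hu IHu]] := IHN (ltnW le); have [u' [hu' IHu']] := one _ le.
    exists (u + u')%N; split.
      apply: eRecS hu _; apply: eval_add_comp.
        exact: (eProj o 1 [:: N, u & v]).
      apply: eComp hu'; apply: esCons (proj2 _ _ _).
      apply: eComp (eSucc o [:: N]); apply: esCons (esNil _ _).
      exact: (eProj o 0 [:: N, u & v]).
    move=> o' a k; rewrite leq_eqVlt => /orP[/eqP ->|lt].
      exact: IHu' (agree_addr a).
    exact: IHu (agree_addl a) _ lt.
  have [u [hu IHu]] := key n (leqnn n); exists u; split.
    apply: eComp hu; apply: esCons (proj0 _).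
    apply: eMin => // k /hk [r [h _]]; by exists r.
  move=> o' a; apply: eMin.
    by have [r [h]] := IHu _ a _ (leqnn n); rewrite eqxx => /eqP <-.
  move=> k lt; have [r [h]] := IHu _ a _ (ltnW lt).
  rewrite (ltn_eqF lt) => /negbT; rewrite -lt0n => r0.
  by exists r.-1; rewrite prednK.
- by move=> v; exists 0%N; split; [exact: eZero|move=> o' _; exact: esNil].
- move=> g gs v w ws h [u [hu IH]] hs [u' [hu' IH']].
  exists (u + u')%N; split; first exact: eval_add_comp hu hu'.
  by move=> o' a; apply: esCons (IH _ (agree_addl a)) (IH' _ (agree_addr a)).
Qed.

(** * Computable functions on natural numbers *)

Definition ctx := (nat -> nat) -> seq nat -> Prop.
Definition fn (T : Type) := (nat -> nat) -> seq nat -> T.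

(* Programs may diverge or be wrong outside the context [P]. *)
Definition cf (P : ctx) (F : fn nat) :=
  exists c, forall o v, P o v -> eval o c v (F o v).

Definition sized (s : nat) (P : ctx) := forall o v, P o v -> size v = s.

(** The new first argument is unconstrained: it serves as the bound variable of a recursion, as a
    search candidate or as an index into a name. *)
Definition push (P : ctx) : ctx :=
  fun o w => if w is _ :: v then P o v else False.

Lemma sized_push s P : sized s P -> sized s.+1 (push P).
Proof. by move=> h o [//|a v] /h /= ->. Qed.

Lemma cf_ext (P : ctx) (F G : fn nat) :
  cf P F -> (forall o v, P o v -> F o v = G o v) -> cf P G.
Proof. by move=> [c hc] h; exists c => o v Pv; rewrite -h //; apply: hc. Qed.

Lemma cf_proj P i : cf P (fun o v => nth 0%N v i).
Proof. by exists (PProj i) => o v _; apply: eProj. Qed.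

Fixpoint cfs (P : ctx) (Fs : seq (fn nat)) : Prop :=
  if Fs is F :: Fs' then cf P F /\ cfs P Fs' else True.

Lemma cf_call P P' H Fs : cf P' H -> cfs P Fs ->
  (forall o v, P o v -> P' o [seq F o v | F <- Fs]) ->
  cf P (fun o v => H o [seq F o v | F <- Fs]).
Proof.
move=> [c hc] hFs hP.
have [gs hgs] : exists gs, forall o v, P o v ->
    evals o gs v [seq F o v | F <- Fs].
  elim: Fs hFs {hP} => [_|F Fs IH [[g hg] /IH[gs hgs]]].
    by exists [::] => o v _; apply: esNil.
  by exists (g :: gs) => o v Pv; apply: esCons; [apply: hg|apply: hgs].
exists (PComp c gs) => o v Pv; apply: eComp (hgs _ _ Pv) (hc _ _ (hP _ _ Pv)).
Qed.

Lemma cfs_proj P i k : cfs P [seq (fun _ v => nth 0%N v j) | j <- iota i k].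
Proof. by elim: k i => [|k IH] i //=; split; [apply: cf_proj|apply: IH]. Qed.

Lemma map_proj (o : nat -> nat) (u v : seq nat) :
  [seq F o (u ++ v) | F : fn nat <-
    [seq (fun _ v => nth 0%N v j) | j <- iota (size u) (size v)]] = v.
Proof.
rewrite -map_comp; apply: (@eq_from_nth _ 0%N).
  by rewrite size_map size_iota.
move=> i; rewrite size_map size_iota => lt.
rewrite (nth_map 0%N) ?size_iota //= nth_iota //.
by rewrite nth_cat ltnNge leq_addr /= addKn.
Qed.

Lemma cf_push s P F : sized s P -> cf P F ->
  cf (push P) (fun o w => F o (behead w)).
Proof.
move=> hs hF.
have h : forall o v, push P o v ->
    [seq F o v | F : fn nat <-
      [seq (fun _ v => nth 0%N v j) | j <- iota 1 s]] = behead v.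
  by move=> o [//|a v] /= /hs <-; have := map_proj o [:: a] v.
apply: cf_ext (cf_call hF (cfs_proj (push P) 1 s) _) _ => o v hv.
  by rewrite h //; case: v hv.
by rewrite h.
Qed.

Lemma cf_zero P : cf P (fun _ _ => 0%N).
Proof. by exists PZero => o v _; apply: eZero. Qed.

Lemma cf_S P F : cf P F -> cf P (fun o v => (F o v).+1).
Proof.
move=> hF; apply: (@cf_call P (fun _ _ => True) (fun o v => (head 0%N v).+1)
  [:: F]) => //.
by exists PSucc => o v _; apply: eSucc.
Qed.

Lemma cf_const P n : cf P (fun _ _ => n).
Proof. by elim: n => [|n IH]; [apply: cf_zero|apply: cf_S]. Qed.

Lemma cf_oracle P F : cf P F -> cf P (fun o v => o (F o v)).
Proof.
move=> hF; apply: (@cf_call P (fun _ _ => True) (fun o v => o (head 0%N v))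
  [:: F]) => //.
by exists POracle => o v _; apply: eOracle.
Qed.

Lemma cf_rec s P (F b : fn nat) (h : fn nat) : sized s P -> cf P F -> cf P b ->
  cf (push (push P)) h ->
  cf P (fun o v => nat_rect (fun _ => nat) (b o v)
                     (fun n r => h o [:: n, r & v]) (F o v)).
Proof.
move=> hs hF [cb hb] [ch hh].
have h0 o v : P o v -> [seq F o v | F : fn nat <-
      [seq (fun _ v => nth 0%N v j) | j <- iota 0 s]] = v.
  by move=> /hs <-; have := map_proj o [::] v.
apply: cf_ext (@cf_call P (push P) (fun o w => nat_rect (fun _ => nat)
   (b o (behead w)) (fun n r => h o [:: n, r & behead w]) (head 0%N w))
   (F :: [seq (fun _ v => nth 0%N v j) | j <- iota 0 s]) _ _ _) _.
- exists (PRec cb ch) => o [//|n v] /= Pv.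
  elim: n => [|n IH] /=; first by apply: eRec0; apply: hb.
  by apply: eRecS IH _; apply: hh.
- by split => //; apply: cfs_proj.
- by move=> o v hv /=; rewrite h0.
- by move=> o v hv /=; rewrite h0.
Qed.

Definition ar (s : nat) : ctx := fun _ v => size v = s.

Lemma sized_ar s : sized s (ar s). Proof. by []. Qed.

(** Closure of [cf] under an operation reduces to a single program of fixed arity. *)
Lemma cf_op1 (op : nat -> nat) : cf (ar 1) (fun _ v => op (nth 0%N v 0)) ->
  forall P F, cf P F -> cf P (fun o v => op (F o v)).
Proof. by move=> h P F hF; apply: (@cf_call _ _ _ [:: F] h). Qed.

Lemma cf_op2 (op : nat -> nat -> nat) :
  cf (ar 2) (fun _ v => op (nth 0%N v 0) (nth 0%N v 1)) ->
  forall P F G, cf P F -> cf P G -> cf P (fun o v => op (F o v) (G o v)).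
Proof. by move=> h P F G hF hG; apply: (@cf_call _ _ _ [:: F; G] h). Qed.

Lemma cf_addn P F G : cf P F -> cf P G -> cf P (fun o v => F o v + G o v)%N.
Proof.
apply: cf_op2; exists p_add => o [|a [|b [|//]]] //= _; apply: eval_add.
Qed.

Lemma cf_muln P F G : cf P F -> cf P G -> cf P (fun o v => F o v * G o v)%N.
Proof.
apply: (@cf_op2 muln); apply: cf_ext (cf_rec (@sized_ar 2) (cf_proj _ 0) (cf_zero _)
  (cf_addn (cf_proj _ 1) (cf_proj _ 3))) _ => o v _ /=.
by elim: (nth 0%N v 0) => //= n ->; rewrite mulSn addnC.
Qed.

Lemma cf_pred P F : cf P F -> cf P (fun o v => (F o v).-1).
Proof.
apply: (@cf_op1 predn); apply: cf_ext (cf_rec (@sized_ar 1) (cf_proj _ 0) (cf_zero _)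
  (cf_proj _ 0)) _ => o v _ /=.
by case: (nth _ _ _).
Qed.

Lemma cf_subn P F G : cf P F -> cf P G -> cf P (fun o v => F o v - G o v)%N.
Proof.
apply: (@cf_op2 subn); apply: cf_ext (cf_rec (@sized_ar 2) (cf_proj _ 1) (cf_proj _ 0)
  (cf_pred (cf_proj _ 1))) _ => o v _ /=.
by elim: (nth _ _ 1) => [|n IH] /=; [rewrite subn0|rewrite subnS IH].
Qed.

Definition cb (P : ctx) (b : fn bool) := cf P (fun o v => b o v : nat).

Lemma cb_leq P F G : cf P F -> cf P G -> cb P (fun o v => F o v <= G o v)%N.
Proof.
move=> hF hG; apply: cf_ext (cf_subn (cf_const _ 1) (cf_subn hF hG)) _ => o v _.
by rewrite -subn_eq0; case: (F o v - G o v)%N.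
Qed.

Lemma cb_neg P b : cb P b -> cb P (fun o v => ~~ b o v).
Proof.
move=> h; apply: cf_ext (cf_subn (cf_const _ 1) h) _ => o v _.
by case: (b o v).
Qed.

Lemma cb_and P b b' : cb P b -> cb P b' -> cb P (fun o v => b o v && b' o v).
Proof.
move=> h h'; apply: cf_ext (cf_muln h h') _ => o v _.
by rewrite mulnb.
Qed.

Lemma cb_eq P F G : cf P F -> cf P G -> cb P (fun o v => F o v == G o v).
Proof.
move=> hF hG; apply: cf_ext (cb_and (cb_leq hF hG) (cb_leq hG hF)) _ => o v _.
by rewrite eqn_leq.
Qed.

Lemma cf_if P b F G : cb P b -> cf P F -> cf P G ->
  cf P (fun o v => if b o v then F o v else G o v).
Proof.
move=> hb hF hG.
apply: cf_ext (cf_addn (cf_muln hb hF) (cf_muln (cb_neg hb) hG)) _ => o v _.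
by case: (b o v); rewrite ?mul1n ?mul0n ?addn0.
Qed.

Lemma cb_all P (I : finType) (b : I -> fn bool) : (forall i, cb P (b i)) ->
  cb P (fun o v => [forall i, b i o v]).
Proof.
move=> h; suff H (r : seq I) : cb P (fun o v => \big[andb/true]_(i <- r) b i o v).
  by apply: cf_ext (H (index_enum I)) _ => o v _; rewrite big_andE.
elim: r => [|i r IH].
  by apply: cf_ext (cf_const P 1) _ => o v _; rewrite big_nil.
by apply: cf_ext (cb_and (h i) IH) _ => o v _; rewrite big_cons.
Qed.

Lemma cf_sum P (I : finType) (F : I -> fn nat) : (forall i, cf P (F i)) ->
  cf P (fun o v => \sum_i F i o v)%N.
Proof.
move=> h; rewrite unlock /reducebig /=.
elim: (index_enum I) => [|i r IH] /=; first exact: cf_zero.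
by apply: cf_addn.
Qed.

(** Only the validity of [T] at the result is kept, not minimality: a search is specified by a
    decidable test together with a proof that some candidate passes it. *)
Lemma cf_search s P (T : fn bool) : sized s P -> cb (push P) T ->
  (forall o v, P o v -> exists e, T o (e :: v)) ->
  exists F, cf P F /\ forall o v, P o v -> T o (F o v :: v).
Proof.
move=> hs /cb_neg [c hc] hT.
have h o v : P o v -> exists e, eval o (PMin c) v e /\ T o (e :: v).
  move=> Pv; exists (ex_minn (hT o v Pv)); case: ex_minnP => n Tn Hn; split => //.
  apply: eMin => [|k lt].
    by have := hc o (n :: v) Pv; rewrite Tn.
  exists 0%N; have := hc o (k :: v) Pv.
  by case Tk : (T o _) => //; have := Hn _ Tk; rewrite leqNgt lt.
exists (fun o v => run o (PMin c) v); split.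
  by exists (PMin c) => o v /h [e [he _]]; rewrite (run_eval he).
by move=> o v /h [e [he]]; rewrite (run_eval he).
Qed.

(** Runs a machine on an oracle that is itself computed, with [v] as parameters; this is where
    [subst_oracle] is used to call a given machine on a computed name. *)
Lemma cf_run s P c (H : fn (nat -> nat)) G : sized s P ->
  cf (push P) (fun o w => H o (behead w) (head 0%N w)) -> cf P G ->
  (forall o v, P o v -> exists r, eval (H o v) c [:: G o v] r) ->
  cf P (fun o v => run (H o v) c [:: G o v]).
Proof.
move=> hs [d hd] hG hr.
have h0 o v : P o v -> [seq F o v | F : fn nat <-
      [seq (fun _ v => nth 0%N v j) | j <- iota 0 s]] = v.
  by move=> /hs <-; have := map_proj o [::] v.
apply: cf_ext (@cf_call P (fun o w => P o (behead w) /\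
     w = G o (behead w) :: behead w) (fun o w => run (H o (behead w)) c
       [:: head 0%N w])
   (G :: [seq (fun _ v => nth 0%N v j) | j <- iota 0 s]) _ _ _) _.
- exists (subst_oracle d s 1 c) => o [[_ //]|k v] /= [Pv [->]].
  rewrite -(hs _ _ Pv); apply: (@eval_subst_oracle o (H o v) d v c [:: G o v]).
    by move=> j; apply: hd.
  exact: eval_run (hr _ _ Pv).
- by split => //; apply: cfs_proj.
- by move=> o v hv /=; rewrite h0.
- by move=> o v hv /=; rewrite h0.
Qed.

Lemma cf_odd P F : cf P F -> cf P (fun o v => odd (F o v) : nat).
Proof.
apply: (@cf_op1 (fun n => odd n : nat)); apply: cf_ext (cf_rec (@sized_ar 1)
  (cf_proj _ 0) (cf_zero _) (cf_subn (cf_const _ 1) (cf_proj _ 1))) _ => o v _ /=.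
by elim: (nth _ _ _) => //= n ->; case: (odd n).
Qed.

Lemma cf_half P F : cf P F -> cf P (fun o v => (F o v)./2).
Proof.
apply: (@cf_op1 half); apply: cf_ext (cf_rec (@sized_ar 1) (cf_proj _ 0)
  (cf_zero _) (cf_addn (cf_odd (cf_proj _ 0)) (cf_proj _ 1))) _ => o v _ /=.
by elim: (nth _ _ _) => //= n ->; rewrite uphalf_half.
Qed.

Lemma cf_pow2 P F : cf P F -> cf P (fun o v => 2 ^ F o v)%N.
Proof.
apply: (@cf_op1 (expn 2)); apply: cf_ext (cf_rec (@sized_ar 1) (cf_proj _ 0)
  (cf_const _ 1) (cf_addn (cf_proj _ 1) (cf_proj _ 1))) _ => o v _ /=.
by elim: (nth _ _ _) => //= n ->; rewrite expnS mul2n addnn.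
Qed.

Lemma cf_tri P F : cf P F -> cf P (fun o v => 'C(F o v + 1, 2)).
Proof.
apply: (@cf_op1 (fun n => 'C(n + 1, 2))); apply: cf_ext (cf_rec (@sized_ar 1)
  (cf_proj _ 0) (cf_zero _) (cf_S (cf_addn (cf_proj _ 0) (cf_proj _ 1)))) _ => o v _ /=.
by elim: (nth 0%N v 0) => //= n ->; rewrite !addn1 [in RHS]binS bin1 addnS addnC.
Qed.

Lemma cf_cpair P F G : cf P F -> cf P G -> cf P (fun o v => cpair (F o v) (G o v)).
Proof. by move=> hF hG; apply: cf_addn (hG); apply: cf_tri; apply: cf_addn. Qed.

Lemma cpair_cunpair n : cpair (cunpair n).1 (cunpair n).2 = n.
Proof.
elim: n => //= n; case: (cunpair n) => -[|a] b; rewrite /cpair /= => <-.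
  by rewrite !addn0 add0n !addn1 [in LHS]binS bin1 addnS.
by rewrite addSnnS addnS.
Qed.

(** The intervals of length [s] starting at the triangular numbers ['C(s + 1, 2)] are disjoint,
    because the next one starts [s + 1] later. *)
Lemma tri_inj s t b c : (b <= s)%N -> (c <= t)%N ->
  ('C(s + 1, 2) + b = 'C(t + 1, 2) + c)%N -> s = t.
Proof.
wlog lt : s t b c / (s < t)%N.
  move=> H hb hc e; case: (ltngtP s t) => // lt; first exact: H lt hb hc e.
  by apply/esym; apply: H lt hc hb (esym e).
move=> hb hc e.
have : ('C(s.+1 + 1, 2) <= 'C(t + 1, 2))%N by apply: leq_bin2l; lia.
rewrite addSn binS bin1; lia.
Qed.

Lemma cpair_inj a b a' b' : cpair a b = cpair a' b' -> a = a' /\ b = b'.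
Proof.
move=> e; have := tri_inj (leq_addl a b) (leq_addl a' b') e.
move: e; rewrite /cpair => + e2; rewrite e2; lia.
Qed.

Lemma cunpair_cpair a b : cunpair (cpair a b) = (a, b).
Proof.
have := cpair_cunpair (cpair a b); case: cunpair => a' b' /= e.
by have [-> ->] := cpair_inj e.
Qed.

(** Consequently an index below [N] in a name asks for a precision below [N]. *)
Lemma leq_cpair a b : (a <= cpair a b)%N.
Proof.
rewrite /cpair addn1 binS bin1; lia.
Qed.

Lemma ltn_cpair a b m : (a < m)%N -> (b < m)%N -> (cpair a b < cpair m m)%N.
Proof.
move=> ha hb; rewrite /cpair -addnS leq_add // leq_bin2l //.
by rewrite leq_add2r leq_add // ltnW.
Qed.

(** The diagonal [a + b] is found by searching for the triangular interval that contains the code;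
    the components follow by subtraction, which avoids a recursion on pairs. *)
Lemma cf_cunpair : cf (ar 1) (fun _ v => (cunpair (nth 0%N v 0)).1) /\
  cf (ar 1) (fun _ v => (cunpair (nth 0%N v 0)).2).
Proof.
pose T : fn bool := fun _ v => ('C(nth 0%N v 0 + 1, 2) <= nth 0%N v 1)%N &&
   (nth 0%N v 1 <= 'C(nth 0%N v 0 + 1, 2) + nth 0%N v 0)%N.
have [|o v hv|W [hW TW]] := @cf_search 1 (ar 1) T (@sized_ar 1).
- apply: cb_and; apply: cb_leq; try exact: cf_proj.
    by apply: cf_tri; apply: cf_proj.
  by apply: cf_addn; [apply: cf_tri|]; apply: cf_proj.
- case: v hv => [|n [|//]] //= _.
  have := cpair_cunpair n; case: cunpair => a b /=; rewrite /cpair => e.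
  exists (a + b)%N; rewrite /T /=; lia.
have WE o v : ar 1 o v ->
  W o v = ((cunpair (nth 0%N v 0)).1 + (cunpair (nth 0%N v 0)).2)%N.
  move=> hv; have := TW _ _ hv; case: v hv => [|n [|//]] //= hv.
  rewrite /T /= => /andP[h1 h2].
  have := cpair_cunpair n; case: cunpair => a b /=; rewrite /cpair => e.
  apply: (@tri_inj _ _ (n - 'C(W o [:: n] + 1, 2)) b); lia.
have h2 : cf (ar 1) (fun _ v => (cunpair (nth 0%N v 0)).2).
  apply: cf_ext (cf_subn (cf_proj _ 0) (cf_tri hW)) _ => o v hv.
  rewrite WE //; have := cpair_cunpair (nth 0%N v 0); rewrite /cpair; lia.
split=> //; apply: cf_ext (cf_subn hW h2) _ => o v hv; rewrite WE //; lia.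
Qed.

Lemma cf_fst P F : cf P F -> cf P (fun o v => (cunpair (F o v)).1).
Proof. by apply: (@cf_op1 (fun n => (cunpair n).1)); case: cf_cunpair. Qed.

Lemma cf_snd P F : cf P F -> cf P (fun o v => (cunpair (F o v)).2).
Proof. by apply: (@cf_op1 (fun n => (cunpair n).2)); case: cf_cunpair. Qed.

(** * Rational arithmetic and names of matrices *)

Lemma cf_app s P (H : fn (nat -> nat)) G : sized s P ->
  cf (push P) (fun o w => H o (behead w) (head 0%N w)) -> cf P G ->
  cf P (fun o v => H o v (G o v)).
Proof.
move=> hs hH hG.
have h0 o v : P o v -> [seq F o v | F : fn nat <-
      [seq (fun _ v => nth 0%N v j) | j <- iota 0 s]] = v.
  by move=> /hs <-; have := map_proj o [::] v.
have hFs : cfs P (G :: [seq (fun _ v => nth 0%N v j) | j <- iota 0 s]).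
  by split => //; apply: cfs_proj.
by apply: cf_ext (cf_call hH hFs _) _ => o v hv /=; rewrite h0.
Qed.

Lemma cf_push_app s P (H : fn (nat -> nat)) : sized s P ->
  cf (push P) (fun o w => H o (behead w) (head 0%N w)) ->
  cf (push (push P)) (fun o w => H o (behead (behead w)) (head 0%N w)).
Proof.
move=> hs hH.
apply: cf_ext (@cf_call (push (push P)) (push P) _
  [seq (fun _ v => nth 0%N v j) | j <- 0%N :: iota 2 s] hH _ _) _.
- by split; [apply: cf_proj|apply: cfs_proj].
- move=> o [//|a [//|b v]] /= Pv.
  by have := map_proj o [:: a; b] v; rewrite (hs _ _ Pv) /= => ->.
- move=> o [//|a [//|b v]] /= Pv.
  by have := map_proj o [:: a; b] v; rewrite (hs _ _ Pv) /= => ->.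
Qed.

(** A case distinction written as a sum with indicators; it merges the programs for the finitely
    many entries of a matrix into one. *)
Lemma cf_select P n S (F : 'I_n -> fn nat) : cf P S -> (forall i, cf P (F i)) ->
  exists G, cf P G /\
    forall o v (i : 'I_n), S o v = i -> G o v = F i o v.
Proof.
move=> hS hF; exists (fun o v => \sum_(i < n) (S o v == i) * F i o v)%N; split.
  by apply: cf_sum => i; apply: cf_muln (hF i); apply: cb_eq hS (cf_const _ _).
move=> o v i e; rewrite (bigD1 i) //= e eqxx mul1n big1 ?addn0 // => j ne.
by rewrite eq_sym (_ : (j == i :> nat) = false) ?mul0n //; apply/negbTE.
Qed.

(** A number is read as an infinite stream of which any finite prefix can be prescribed, so
    candidates of a search need no stored length. *)
Definition untuple (e i : nat) : nat :=
  (cunpair (iter i (fun e => (cunpair e).2) e)).1.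

Lemma cf_untuple P F i : cf P F -> cf P (fun o v => untuple (F o v) i).
Proof.
by move=> hF; apply: cf_fst; elim: i => [|i IH] //=; apply: cf_snd.
Qed.

Lemma untuple_onto (f : nat -> nat) N :
  exists e, forall i, (i < N)%N -> untuple e i = f i.
Proof.
elim: N f => [|N IH] f; first by exists 0%N.
have [e he] := IH (fun i => f i.+1).
exists (cpair (f 0%N) e) => -[|i] lt; rewrite /untuple ?iterSr cunpair_cpair //=.
exact: he.
Qed.

Section Rationals.
Variable R : realType.
Implicit Types (P : ctx) (Q : fn R).

Definition zenc (z : int) : nat :=
  match z with Posz n => n.*2 | Negz n => n.*2.+1 end.

Lemma zencK : cancel zenc zdec.
Proof.
case=> n; rewrite /zdec /= ?odd_double ?doubleK //.
by rewrite uphalf_double NegzE.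
Qed.

Lemma qdec_frac (z : int) (c : nat) :
  qdec (cpair (zenc z) c) = z%:~R / c.+1%:R :> R.
Proof. by rewrite /qdec cunpair_cpair zencK. Qed.

Lemma qdec_dense (x e : R) : 0 < e -> exists n, `|x - qdec n| < e.
Proof.
move=> e0; have [N hN] : exists N : nat, e^-1 < N.+1%:R.
  exists (Num.truncn e^-1).
  by have := truncn_itv (ltW (_ : 0 < e^-1)); rewrite invr_gt0 => /(_ e0) /andP[].
exists (cpair (zenc (Num.floor (x * N.+1%:R))) N); rewrite qdec_frac.
have N0 : 0 < N.+1%:R :> R by [].
have /andP[h1 h2] := floor_itv (x * N.+1%:R).
have -> : x - (Num.floor (x * N.+1%:R))%:~R / N.+1%:R =
    (x * N.+1%:R - (Num.floor (x * N.+1%:R))%:~R) / N.+1%:R.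
  by rewrite mulrBl mulfK // gt_eqF.
rewrite ger0_norm; last by rewrite divr_ge0 // subr_ge0.
rewrite ltr_pdivrMr //; apply: lt_trans (_ : 1 < _).
  by move: h2; rewrite intrD ltrBlDl addrC.
by rewrite -ltr_pdivrMl // mulr1.
Qed.

(* Signed fractions of natural numbers: closing [cq] under the field operations
   only takes sums and products of naturals. *)
Definition cq P Q := exists A B C, [/\ cf P A, cf P B, cf P C &
  forall o v, P o v -> Q o v = ((A o v)%:R - (B o v)%:R) / (C o v).+1%:R].

Lemma cq_ext P Q Q' : cq P Q -> (forall o v, P o v -> Q o v = Q' o v) -> cq P Q'.
Proof.
move=> [A [B [C [hA hB hC h]]]] e; exists A, B, C; split=> // o v Pv.
by rewrite -e // h.
Qed.

Lemma cq_nat P F : cf P F -> cq P (fun o v => (F o v)%:R).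
Proof.
move=> hF; exists F, (fun _ _ => 0%N), (fun _ _ => 0%N); split => //;
  try exact: cf_zero.
by move=> o v _; rewrite subr0 divr1.
Qed.

Lemma cq_opp P Q : cq P Q -> cq P (fun o v => - Q o v).
Proof.
move=> [A [B [C [hA hB hC h]]]]; exists B, A, C; split=> // o v Pv.
by rewrite h // -mulNr opprB.
Qed.

(** Denominators are stored minus one so that they never vanish; the left side is their product in
    this encoding. *)
Lemma mul_succ_pred (a b : nat) : (a * b + a + b).+1 = (a.+1 * b.+1)%N.
Proof. lia. Qed.

Lemma cq_add P Q Q' : cq P Q -> cq P Q' -> cq P (fun o v => Q o v + Q' o v).
Proof.
move=> [A [B [C [hA hB hC h]]]] [A' [B' [C' [hA' hB' hC' h']]]].
exists (fun o v => A o v * (C' o v).+1 + A' o v * (C o v).+1)%N,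
  (fun o v => B o v * (C' o v).+1 + B' o v * (C o v).+1)%N,
  (fun o v => C o v * C' o v + C o v + C' o v)%N; split.
- by apply: cf_addn; apply: cf_muln => //; apply: cf_S.
- by apply: cf_addn; apply: cf_muln => //; apply: cf_S.
- by apply: cf_addn => //; apply: cf_addn => //; apply: cf_muln.
move=> o v Pv; rewrite h // h' // mul_succ_pred !natrD !natrM.
have n0 : (C o v).+1%:R != 0 :> R by rewrite pnatr_eq0.
have n1 : (C' o v).+1%:R != 0 :> R by rewrite pnatr_eq0.
by field; apply/andP.
Qed.

Lemma cq_mul P Q Q' : cq P Q -> cq P Q' -> cq P (fun o v => Q o v * Q' o v).
Proof.
move=> [A [B [C [hA hB hC h]]]] [A' [B' [C' [hA' hB' hC' h']]]].
exists (fun o v => A o v * A' o v + B o v * B' o v)%N,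
  (fun o v => A o v * B' o v + B o v * A' o v)%N,
  (fun o v => C o v * C' o v + C o v + C' o v)%N; split.
- by apply: cf_addn; apply: cf_muln.
- by apply: cf_addn; apply: cf_muln.
- by apply: cf_addn => //; apply: cf_addn => //; apply: cf_muln.
move=> o v Pv; rewrite h // h' // mul_succ_pred !natrD !natrM.
have n0 : (C o v).+1%:R != 0 :> R by rewrite pnatr_eq0.
have n1 : (C' o v).+1%:R != 0 :> R by rewrite pnatr_eq0.
by field; apply/andP.
Qed.

Lemma cq_subr P Q Q' : cq P Q -> cq P Q' -> cq P (fun o v => Q o v - Q' o v).
Proof. by move=> h /cq_opp; apply: cq_add. Qed.

Lemma cq_qdec P F : cf P F -> cq P (fun o v => qdec (F o v)).
Proof.
move=> hF; pose a : fn nat := fun o v => (cunpair (F o v)).1.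
have ha : cf P a by apply: cf_fst.
exists (fun o v => if odd (a o v) then 0%N else (a o v)./2),
  (fun o v => if odd (a o v) then (a o v)./2.+1 else 0%N),
  (fun o v => (cunpair (F o v)).2); split.
- by apply: cf_if; [apply: cf_odd|apply: cf_zero|apply: cf_half].
- by apply: cf_if; [apply: cf_odd|apply: cf_S; apply: cf_half|apply: cf_zero].
- exact: cf_snd.
move=> o v _; rewrite /qdec /a; case: cunpair => x y /=; rewrite /zdec.
by case: (odd x); rewrite ?mulrNz ?sub0r ?subr0.
Qed.

Lemma cq_const P n : cq P (fun _ _ => qdec n).
Proof. by apply: cq_qdec; apply: cf_const. Qed.

Lemma cq_natc P n : cq P (fun _ _ => n%:R).
Proof. by apply: cq_nat; apply: cf_const. Qed.

Lemma cq_inv_succ P F : cf P F -> cq P (fun o v => (F o v).+1%:R^-1).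
Proof.
move=> hF; exists (fun _ _ => 1%N), (fun _ _ => 0%N), F; split => //;
  try exact: cf_const.
by move=> o v _; rewrite subr0 mul1r.
Qed.

Lemma cq_pow2 P F : cf P F -> cq P (fun o v => 2 ^- F o v).
Proof.
move=> /cf_pow2 /cf_pred /cq_inv_succ h; apply: cq_ext h _ => o v _.
by rewrite prednK ?expn_gt0 // natrX.
Qed.

Lemma cq_norm P Q : cq P Q -> cq P (fun o v => `|Q o v|).
Proof.
move=> [A [B [C [hA hB hC h]]]].
exists (fun o v => (A o v - B o v) + (B o v - A o v))%N, (fun _ _ => 0%N), C.
split => //; first by apply: cf_addn; apply: cf_subn.
  exact: cf_zero.
move=> o v Pv; rewrite h // normrM normfV [X in _ / X]ger0_norm // subr0.
congr (_ / _); have [le|/ltnW le] := leqP (A o v) (B o v).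
  move: (le); rewrite -subn_eq0 => /eqP ->; rewrite add0n natrB //.
  by rewrite distrC ger0_norm // subr_ge0 ler_nat.
move: (le); rewrite -subn_eq0 => /eqP ->; rewrite addn0 natrB //.
by rewrite ger0_norm // subr_ge0 ler_nat.
Qed.

Lemma cb_ler P Q Q' : cq P Q -> cq P Q' -> cb P (fun o v => Q o v <= Q' o v).
Proof.
move=> hQ hQ'; have [A [B [C [hA hB hC h]]]] := cq_subr hQ' hQ.
apply: cf_ext (cb_leq hB hA) _ => o v Pv; congr nat_of_bool.
rewrite -[RHS]subr_ge0 h // pmulr_lge0 ?invr_gt0 ?ltr0Sn //.
by rewrite subr_ge0 ler_nat.
Qed.

Lemma cb_ltr P Q Q' : cq P Q -> cq P Q' -> cb P (fun o v => Q o v < Q' o v).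
Proof.
move=> hQ hQ'; apply: cf_ext (cb_neg (cb_ler hQ' hQ)) _ => o v Pv.
by rewrite ltNge.
Qed.

Lemma cq_if P b Q Q' : cb P b -> cq P Q -> cq P Q' ->
  cq P (fun o v => if b o v then Q o v else Q' o v).
Proof.
move=> hb [A [B [C [hA hB hC h]]]] [A' [B' [C' [hA' hB' hC' h']]]].
exists (fun o v => if b o v then A o v else A' o v),
  (fun o v => if b o v then B o v else B' o v),
  (fun o v => if b o v then C o v else C' o v).
split; try exact: cf_if.
by move=> o v Pv; case: (b o v); rewrite ?h ?h'.
Qed.

Lemma cq_sum P (I : finType) (Q : I -> fn R) : (forall i, cq P (Q i)) ->
  cq P (fun o v => \sum_i Q i o v).
Proof.
move=> h; rewrite unlock /reducebig /=.
elim: (index_enum I) => [|i r IH] /=; first exact: (cq_natc P 0).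
exact: cq_add.
Qed.

Lemma cq_code P Q : cq P Q ->
  exists F, cf P F /\ forall o v, P o v -> qdec (F o v) = Q o v.
Proof.
move=> [A [B [C [hA hB hC h]]]].
(* [zdec] sends [2 k] to [k] and, for positive [k], [2 k - 1] to [- k]. *)
exists (fun o v => cpair (if B o v <= A o v then 2 * (A o v - B o v) else
   2 * (B o v - A o v) - 1)%N (C o v)); split.
  apply: cf_cpair hC; apply: cf_if; first exact: cb_leq.
    by apply: cf_muln; [apply: cf_const|apply: cf_subn].
  apply: cf_subn; last exact: cf_const.
  by apply: cf_muln; [apply: cf_const|apply: cf_subn].
move=> o v Pv; rewrite h // /qdec cunpair_cpair; congr (_ / _).
rewrite /zdec; case: leqP => le.
  by rewrite mul2n odd_double doubleK -natrB.
have {1 2}-> : (2 * (B o v - A o v) - 1 = (B o v - A o v).-1.*2.+1)%N by lia.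
rewrite /= odd_double uphalf_double prednK ?subn_gt0 // mulrNz.
by rewrite -pmulrn natrB ?opprB // ltnW.
Qed.

Section Names.
Variables (s m n : nat).
Implicit Type X : fn 'M[R]_(m, n).

(* [X] is computable relative to the oracle and the arguments. *)
Definition cmx P X := exists H : fn (nat -> nat),
  cf (push P) (fun o w => H o (behead w) (head 0%N w)) /\
  forall o v, P o v -> rhoM (H o v) (X o v).

Lemma cmx_ext P X X' : cmx P X -> (forall o v, P o v -> X o v = X' o v) ->
  cmx P X'.
Proof.
by move=> [H [hH h]] e; exists H; split => // o v Pv; rewrite -e //; apply: h.
Qed.

(** Passes from a name to rational approximations at a computed precision; [cmx_build] is the way
    back. Between the two, algorithms only handle rationals. *)
Lemma cmx_approx P X N : sized s P -> cmx P X -> cf P N ->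
  exists Q : 'I_m -> 'I_n -> fn R, (forall i j, cq P (Q i j)) /\
    forall o v, P o v -> forall i j, `|X o v i j - Q i j o v| <= 2 ^- N o v.
Proof.
move=> hs [H [hH h]] hN.
exists (fun i j o v => qdec (H o v (cpair (N o v) (cpair i j)))); split.
  move=> i j; apply: cq_qdec; apply: cf_app hs hH _.
  by apply: cf_cpair hN (cf_const _ _).
by move=> o v Pv i j; apply: h.
Qed.

Lemma cmx_build P X (Q : 'I_m -> 'I_n -> fn R) : sized s P ->
  (forall i j, cq (push P) (Q i j)) ->
  (forall o v a, P o v -> forall i j, `|X o v i j - Q i j o (a :: v)| <= 2 ^- a) ->
  cmx P X.
Proof.
move=> hs hQ hX.
have hs1 := sized_push hs.
have hF i j := cq_code (hQ i j).
pose F i j := projT1 (cid (hF i j)).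
have cF i j : cf (push P) (F i j) by case: (projT2 (cid (hF i j))).
have eF i j o v : push P o v -> qdec (F i j o v) = Q i j o v.
  by case: (projT2 (cid (hF i j))) => _; apply.
pose I : fn nat := fun o v => (cunpair (cunpair (nth 0%N v 0)).2).1.
pose J : fn nat := fun o v => (cunpair (cunpair (nth 0%N v 0)).2).2.
have cI P' : cf P' I by apply: cf_fst; apply: cf_snd; apply: cf_proj.
have cJ P' : cf P' J by apply: cf_snd; apply: cf_snd; apply: cf_proj.
(* a name receives the index [cpair a (cpair i j)] where [Q] expects [a] *)
have cF' i j : cf (push P) (fun o w =>
    F i j o ((cunpair (nth 0%N w 0)).1 :: behead w)).
  apply: cf_ext (@cf_call (push P) (push P) (F i j)
    ((fun _ v => (cunpair (nth 0%N v 0)).1) ::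
       [seq (fun _ v => nth 0%N v j) | j <- iota 1 s]) _ _ _) _ => //.
  - by split; [apply: cf_fst; apply: cf_proj|apply: cfs_proj].
  - move=> o [//|a v] /= Pv.
    by have := map_proj o [:: a] v; rewrite (hs _ _ Pv) /= => ->.
  - move=> o [//|a v] /= Pv.
    by have := map_proj o [:: a] v; rewrite (hs _ _ Pv) /= => ->.
have G1 i := cf_select (cJ _) (cF' i).
pose G i := projT1 (cid (G1 i)).
have cG i : cf (push P) (G i) by case: (projT2 (cid (G1 i))).
have eG i o v (j : 'I_n) : J o v = j ->
    G i o v = F i j o ((cunpair (nth 0%N v 0)).1 :: behead v).
  by case: (projT2 (cid (G1 i))) => _; apply.
have [K [cK eK]] := cf_select (cI _) cG.
exists (fun o v k => K o (k :: v)); split.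
  by apply: cf_ext cK _ => o [].
move=> o v Pv k i j.
have eI : I o (cpair k (cpair i j) :: v) = i by rewrite /I /= !cunpair_cpair.
have eJ : J o (cpair k (cpair i j) :: v) = j by rewrite /J /= !cunpair_cpair.
rewrite (eK _ _ _ eI) (eG _ _ _ _ eJ) /= eF // !cunpair_cpair.
exact: hX.
Qed.

Lemma cmx_exact P X : sized s P -> (forall i j, cq P (fun o v => X o v i j)) ->
  cmx P X.
Proof.
move=> hs hX; apply: (cmx_build hs (Q := fun i j o w => X o (behead w) i j)).
  move=> i j; have [A [B [C [hA hB hC h]]]] := hX i j.
  exists (fun o w => A o (behead w)), (fun o w => B o (behead w)),
    (fun o w => C o (behead w)).
  by split; try exact: (cf_push hs); move=> o [//|a v] /= /h.
by move=> o v a Pv i j; rewrite subrr normr0 invr_ge0 exprn_ge0.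
Qed.

Lemma cmx_push P X : sized s P -> cmx P X ->
  cmx (push P) (fun o w => X o (behead w)).
Proof.
move=> hs [H [hH h]]; exists (fun o w => H o (behead w)); split.
  exact: cf_push_app hs hH.
by move=> o [//|a v] /= /h.
Qed.

(** The form of the later algorithms with real output: for precision [a], search a candidate [e]
    whose test guarantees an error of at most [2 ^- a]. The candidate may depend on the name and not
    only on the point. *)
Lemma cmx_search P X (T : fn bool) (Q : 'I_m -> 'I_n -> fn R) : sized s P ->
  cb (push (push P)) T -> (forall i j, cq (push (push P)) (Q i j)) ->
  (forall o v a, P o v -> exists e, T o [:: e, a & v]) ->
  (forall o v a e, P o v -> T o [:: e, a & v] ->
     forall i j, `|X o v i j - Q i j o [:: e, a & v]| <= 2 ^- a) ->
  cmx P X.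
Proof.
move=> hs hT hQ hex hap.
have hs1 := sized_push hs.
have [|F [cF hF]] := cf_search hs1 hT; first by move=> o [//|a v] /=; apply: hex.
apply: (cmx_build hs (Q := fun i j o w => Q i j o (F o w :: w))).
  have call G : cf (push (push P)) G -> cf (push P) (fun o w => G o (F o w :: w)).
    have hFs := cfs_proj (push P) 0 s.+1.
    have eFs o v : push P o v -> [seq F o v | F : fn nat <-
        [seq (fun _ v => nth 0%N v j) | j <- iota 0 s.+1]] = v.
      by move=> /hs1 <-; have := map_proj o [::] v.
    move: [seq _ | j <- iota 0 s.+1] hFs eFs => Fs hFs eFs hG.
    by apply: cf_ext (@cf_call (push P) _ _ (F :: Fs) hG _ _) _ => [|o v Pv|o v Pv];
      rewrite /= ?eFs.
  move=> i j; have [A [B [C [hA hB hC h]]]] := hQ i j.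
  exists (fun o w => A o (F o w :: w)), (fun o w => B o (F o w :: w)),
    (fun o w => C o (F o w :: w)).
  by split; try exact: call; move=> o v Pv; apply: h.
by move=> o v a Pv; apply: hap => //; apply: hF.
Qed.

End Names.
End Rationals.

(** * Points given by names, and operations on them *)

Section Functions.
Variable R : realType.

Lemma pow2_ge (x : R) : exists k, x <= 2 ^+ k.
Proof.
exists (Num.truncn x).+1; have [x0|/ltW x0] := leP 0 x; last first.
  by apply: le_trans x0 _; rewrite exprn_ge0.
have /andP[_ /ltW /le_trans] := truncn_itv x0; apply.
by rewrite -natrX ler_nat ltnW // ltn_expl.
Qed.

Lemma pow2_lt (x : R) : 0 < x -> exists k, 2 ^- k < x.
Proof.
move=> x0; have [k hk] := pow2_ge x^-1; exists k.+1.
rewrite -[x]invrK ltf_pV2 ?qualifE /= ?exprn_gt0 ?invr_gt0 //.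
by apply: le_lt_trans hk _; rewrite exprS ltr_pMl ?exprn_gt0 // ltr1n.
Qed.

Lemma pow2D (a b : nat) : 2 ^- (a + b) = 2 ^- a * 2 ^- b :> R.
Proof. by rewrite exprD invfM. Qed.

Lemma pow2_gt0 k : 0 < 2 ^- k :> R.
Proof. by rewrite invr_gt0 exprn_gt0. Qed.

Lemma pow2_half k : 2 ^- k.+1 = 2 ^- k / 2 :> R.
Proof. by rewrite exprSr invfM. Qed.

Lemma small_eq0 (x : R) : (forall k, `|x| <= 2 ^- k) -> x = 0.
Proof.
move=> h; apply/eqP; rewrite -normr_le0 leNgt; apply/negP => /pow2_lt[k].
by rewrite ltNge h.
Qed.

Lemma rhoM_inj m n p (A B : 'M[R]_(m, n)) : rhoM p A -> rhoM p B -> A = B.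
Proof.
move=> hA hB; apply/matrixP => i j; apply/eqP; rewrite -subr_eq0; apply/eqP.
apply: small_eq0 => k; have := hA k.+1 i j; have := hB k.+1 i j.
have := pow2_half k; set q := qdec _; set u := 2 ^- k; set v := 2 ^- _ => e.
rewrite !ler_norml => /andP[h1 h2] /andP[h3 h4]; apply/andP; split; lra.
Qed.

(** The situation of a machine for a function on [D]: no arguments, and an oracle naming a point of
    [D]. This point is unique by [rhoM_inj], so [named_point] turns functions of points into
    functions of oracles. *)
Definition named n (D : set 'rV[R]_n) : ctx :=
  fun o v => v = [::] /\ exists2 x, D x & rho o x.

Definition named_point n (D : set 'rV[R]_n) : fn 'rV[R]_n :=
  fun o _ => xget 0 [set x | D x /\ rho o x].

Lemma sized_named n (D : set 'rV[R]_n) : sized 0 (named D).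
Proof. by move=> o v [->]. Qed.

Lemma named_pointP n (D : set 'rV[R]_n) o v : named D o v ->
  D (named_point D o v) /\ rho o (named_point D o v).
Proof. by move=> [_ [x Dx hx]]; rewrite /named_point; case: xgetP => // /(_ x) []. Qed.

Lemma named_point_eq n (D : set 'rV[R]_n) o v x : D x -> rho o x -> named_point D o v = x.
Proof.
move=> Dx hx; have hn : named D o [::] by split => //; exists x.
by have [_ h] := named_pointP hn; apply: rhoM_inj h hx.
Qed.

Lemma cmx_named_point n (D : set 'rV[R]_n) : cmx (named D) (named_point D).
Proof.
exists (fun o _ => o); split; last by move=> o v /named_pointP[].
by apply: cf_ext (cf_oracle (cf_proj _ 0)) _ => o [].
Qed.

Lemma computable_on_cmx n m k (D : set 'rV[R]_n) (h : 'rV[R]_n -> 'M[R]_(m, k)) :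
  cmx (named D) (fun o v => h (named_point D o v)) -> computable_on D h.
Proof.
move=> [H [[c hc] hH]]; exists c => x Dx p hp; exists (H p [::]).
have hn : named D p [::] by split => //; exists x.
split; first by move=> j; have := hc p [:: j] hn.
by have := hH _ _ hn; rewrite (named_point_eq _ Dx hp).
Qed.

(** The machine for [h] is run on the computed name of [X o v]; correctness on all names makes the
    particular one irrelevant. *)
Lemma cmx_comp s P n m k (D : set 'rV[R]_n) (h : 'rV[R]_n -> 'M[R]_(m, k))
    (X : fn 'rV[R]_n) :
  computable_on D h -> sized s P -> cmx P X -> (forall o v, P o v -> D (X o v)) ->
  cmx P (fun o v => h (X o v)).
Proof.
move=> [c hc] hs hX hD; have [H [hH rH]] := hX.
have hrun o v : P o v -> (forall j, eval (H o v) c [:: j] (run (H o v) c [:: j]))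
    /\ rhoM (fun j => run (H o v) c [:: j]) (h (X o v)).
  move=> Pv; have [q [cq rq]] := hc _ (hD _ _ Pv) _ (rH _ _ Pv).
  split; first by move=> j; apply: eval_run; exists (q j).
  suff -> : (fun j => run (H o v) c [:: j]) = q by [].
  by apply/funext => j; apply: run_eval.
exists (fun o v j => run (H o v) c [:: j]); split; last by move=> o v /hrun[].
apply: (@cf_run s.+1 (push P) c (fun o w => H o (behead w))
  (fun _ w => head 0%N w)) => //.
- exact: sized_push.
- exact: cf_push_app hs hH.
- by apply: cf_ext (cf_proj _ 0) _ => o [].
- by move=> o [//|a v] /= /hrun[h1 _]; exists (run (H o v) c [:: a]).
Qed.

Lemma cmx_computable_vec s P n (x : 'rV[R]_n) : sized s P -> computable_vec x ->
  cmx P (fun _ _ => x).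
Proof.
move=> hs [q [rq [c hc]]]; exists (fun _ _ => q); split => //.
(* The program of [x] was given for the zero oracle, which [PZero] simulates. *)
exists (subst_oracle PZero s 1 c) => o [//|a v] /= Pv.
rewrite -(hs _ _ Pv).
apply: (@eval_subst_oracle o (fun _ => 0%N) PZero v c [:: a]) (hc a).
by move=> k; apply: eZero.
Qed.

Section Closure.
Variables (s : nat) (P : ctx).
Hypothesis hs : sized s P.

Lemma cmx_add m n (X Y : fn 'M[R]_(m, n)) : cmx P X -> cmx P Y ->
  cmx P (fun o v => X o v + Y o v).
Proof.
move=> /(cmx_push hs) hX /(cmx_push hs) hY; have hs1 := sized_push hs.
have [|Q [cQ aQ]] := @cmx_approx R s.+1 _ _ _ _ (fun _ w => (head 0%N w).+1) hs1 hX.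
  by apply: cf_S; apply: cf_ext (cf_proj _ 0) _ => o [].
have [|Q' [cQ' aQ']] := @cmx_approx R s.+1 _ _ _ _ (fun _ w => (head 0%N w).+1) hs1 hY.
  by apply: cf_S; apply: cf_ext (cf_proj _ 0) _ => o [].
apply: (cmx_build hs (Q := fun i j o w => Q i j o w + Q' i j o w)).
  by move=> i j; apply: cq_add.
move=> o v a Pv i j; have /= h1 := aQ o (a :: v) Pv i j.
have /= h2 := aQ' o (a :: v) Pv i j.
rewrite !mxE opprD addrACA; apply: le_trans (ler_normD _ _) _.
by rewrite -[2 ^- a]add0r; apply: le_trans (lerD h1 h2) _;
  rewrite pow2_half -splitr add0r.
Qed.

Lemma cmx_opp m n (X : fn 'M[R]_(m, n)) : cmx P X -> cmx P (fun o v => - X o v).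
Proof.
move=> /(cmx_push hs) hX; have hs1 := sized_push hs.
have [|Q [cQ aQ]] := @cmx_approx R s.+1 _ _ _ _ (fun _ w => head 0%N w) hs1 hX.
  by apply: cf_ext (cf_proj _ 0) _ => o [].
apply: (cmx_build hs (Q := fun i j o w => - Q i j o w)).
  by move=> i j; apply: cq_opp.
move=> o v a Pv i j; have /= h1 := aQ o (a :: v) Pv i j.
by rewrite !mxE -opprD normrN.
Qed.

Lemma cmx_trmx m n (X : fn 'M[R]_(m, n)) : cmx P X -> cmx P (fun o v => (X o v)^T).
Proof.
move=> /(cmx_push hs) hX; have hs1 := sized_push hs.
have [|Q [cQ aQ]] := @cmx_approx R s.+1 _ _ _ _ (fun _ w => head 0%N w) hs1 hX.
  by apply: cf_ext (cf_proj _ 0) _ => o [].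
apply: (cmx_build hs (Q := fun i j o w => Q j i o w)) => //.
by move=> o v a Pv i j; rewrite mxE; apply: (aQ o (a :: v)).
Qed.

Definition rational_mx m n (W : 'M[R]_(m, n)) := forall i j, exists c, W i j = qdec c.

Lemma cq_rational_mx P' m n (W : 'M[R]_(m, n)) i j : rational_mx W ->
  cq P' (fun _ _ => W i j).
Proof. by move=> /(_ i j) [c ->]; apply: cq_const. Qed.

Lemma cmx_mulmxr m n k (X : fn 'M[R]_(m, n)) (W : 'M[R]_(n, k)) :
  rational_mx W -> cmx P X -> cmx P (fun o v => X o v *m W).
Proof.
move=> rW /(cmx_push hs) hX; have hs1 := sized_push hs.
(* [K] guard bits absorb the amplification of errors by [W]. *)
have [K hK] := pow2_ge (\sum_i \sum_j `|W i j|).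
have [|Q [cQ aQ]] :=
    @cmx_approx R s.+1 _ _ _ _ (fun _ w => (head 0%N w + K)%N) hs1 hX.
  by apply: cf_addn (cf_const _ _); apply: cf_ext (cf_proj _ 0) _ => o [].
apply: (cmx_build hs (Q := fun i j o w => \sum_l Q i l o w * W l j)).
  move=> i j; apply: cq_sum => l; apply: cq_mul => //; exact: cq_rational_mx.
move=> o v a Pv i j; have /= h1 := aQ o (a :: v) Pv i.
rewrite mxE -sumrB; apply: le_trans (ler_norm_sum _ _ _) _.
apply: (@le_trans _ _ (\sum_l 2 ^- (a + K) * `|W l j|)).
  by apply: ler_sum => l _; rewrite -mulrBl normrM ler_wpM2r.
rewrite -mulr_sumr pow2D -mulrA ler_piMr //.
rewrite ler_pdivrMl ?exprn_gt0 // mulr1; apply: le_trans hK.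
apply: ler_sum => l _; rewrite (bigD1 j) //= lerDl; exact: sumr_ge0.
Qed.

End Closure.
End Functions.

(** * Norms and differentials *)

Section Norms.
Variable R : realType.

Lemma mx_coord_le_norm m n (x : 'M[R]_(m, n)) i j : `|x i j| <= `|x|.
Proof.
rewrite -[leRHS]/(mx_norm x) mx_normrE.
exact: (le_bigmax_cond _ (fun ij : 'I_m * 'I_n => `|x ij.1 ij.2|) (j := (i, j))).
Qed.

Lemma mx_norm_le m n (x : 'M[R]_(m, n)) e :
  0 <= e -> (forall i j, `|x i j| <= e) -> `|x| <= e.
Proof.
move=> e0 h; rewrite -[leLHS]/(mx_norm x) mx_normrE.
by apply/bigmax_leP; split => //= -[i j] _ /=.
Qed.

Lemma coord_le_norm n (x : 'rV[R]_n) j : `|x ord0 j| <= `|x|.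
Proof. exact: mx_coord_le_norm. Qed.

Lemma norm_le n (x : 'rV[R]_n) e :
  0 <= e -> (forall j, `|x ord0 j| <= e) -> `|x| <= e.
Proof. by move=> e0 h; apply: mx_norm_le => // i j; rewrite (ord1 i). Qed.

(** Row vectors are multiplied from the left, so the operator norm for the sup norm is controlled by
    column sums. *)
Lemma norm_mulmx m n (t : 'rV[R]_m) (E : 'M[R]_(m, n)) e : 0 <= e ->
  (forall j, \sum_i `|E i j| <= e) -> `|t *m E| <= `|t| * e.
Proof.
move=> e0 hE; apply: norm_le; first exact: mulr_ge0.
move=> j; rewrite mxE; apply: le_trans (ler_norm_sum _ _ _) _.
apply: le_trans (_ : \sum_i `|t| * `|E i j| <= _).
  by apply: ler_sum => i _; rewrite normrM ler_wpM2r // coord_le_norm.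
by rewrite -mulr_sumr ler_wpM2l.
Qed.

Lemma norm_mulmx_bound m n (E : 'M[R]_(m, n)) :
  exists2 K, 0 < K & forall t : 'rV[R]_m, `|t *m E| <= `|t| * K.
Proof.
exists (1 + \sum_i \sum_j `|E i j|).
  by rewrite ltr_pwDl // sumr_ge0 // => i _; apply: sumr_ge0.
move=> t; apply: norm_mulmx.
  by rewrite addr_ge0 // sumr_ge0 // => i _; apply: sumr_ge0.
move=> j; rewrite -[leLHS]add0r lerD //.
by apply: ler_sum => i _; rewrite (bigD1 j) //= lerDl; apply: sumr_ge0.
Qed.

(** This lemma and the next ones translate continuity and differentiability, in both directions,
    into epsilon-delta statements with non-strict bounds. *)
Lemma le_continuous (V W : normedModType R) (f : V -> W) x :
  (forall e, 0 < e -> exists2 d, 0 < d & forall y, `|x - y| <= d ->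
     `|f x - f y| <= e) -> {for x, continuous f}.
Proof.
move=> h; apply/cvgrPdist_le => e /h [d d0 hd]; rewrite nearE; apply/nbhs_ballP.
by exists d => // u; rewrite -ball_normE => /ltW /hd.
Qed.

Lemma continuous_le (V W : normedModType R) (f : V -> W) x :
  {for x, continuous f} ->
  forall e, 0 < e -> exists2 d, 0 < d & forall y, `|x - y| <= d ->
     `|f x - f y| <= e.
Proof.
move=> /cvgrPdist_le h e /h; rewrite nearE => /nbhs_ballP[d d0 hd].
exists (d / 2); first by rewrite divr_gt0.
move=> y hy; apply: hd; rewrite -ball_normE /=; apply: le_lt_trans hy _.
by rewrite ltr_pdivrMr // ltr_pMr // ltr1n.
Qed.

Lemma continuous_mulmxr m n (E : 'M[R]_(m, n)) : continuous (mulmxr E : 'rV[R]_m -> 'rV[R]_n).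
Proof.
have [K K0 hK] := norm_mulmx_bound E.
move=> t; apply: le_continuous => e e0; exists (e / K); first exact: divr_gt0.
by move=> u; rewrite ler_pdivlMr //= -mulmxBl; apply: le_trans.
Qed.

Lemma diff_le (V W : normedModType R) (f : V -> W) (x : V) : differentiable f x ->
  forall e, 0 < e -> exists2 d, 0 < d & forall h, `|h| <= d ->
    `|f (x + h) - f x - 'd f x h| <= e * `|h|.
Proof.
move=> /diff_locally /eqaddoP h e e0.
have := h e e0; rewrite nearE => /nbhs_ballP [d d0 hd].
exists (d / 2); first by rewrite divr_gt0.
move=> u hu; have := hd u; rewrite -ball_normE /= sub0r normrN.
have lt : `|u| < d by apply: le_lt_trans hu _; rewrite ltr_pdivrMr // ltr_pMr // ltr1n.
by move=> /(_ lt); rewrite !fctE /= opprD addrA [u + x]addrC.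
Qed.

Lemma le_diff (V W : normedModType R) (f : V -> W) (x : V) (df : {linear V -> W}) :
  continuous df ->
  (forall e, 0 < e -> exists2 d, 0 < d & forall h, `|h| <= d ->
    `|f (x + h) - f x - df h| <= e * `|h|) ->
  differentiable f x /\ forall h, 'd f x h = df h.
Proof.
move=> cdf h.
have H : f \o shift x = cst (f x) + df +o_0 id.
  apply/eqaddoP => e e0; have [d d0 hd] := h e e0.
  rewrite nearE; apply/nbhs_ballP; exists d => // u.
  rewrite -ball_normE /= sub0r normrN => /ltW /hd.
  by rewrite !fctE /= opprD addrA [u + x]addrC.
have E := diff_unique cdf H.
split; last by move=> u; rewrite -E.
by apply/diff_locallyP; rewrite E.
Qed.

Lemma enorm_sqr n (v : 'rV[R]_n) : enorm v ^+ 2 = \sum_i v ord0 i ^+ 2.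
Proof. by rewrite sqr_sqrtr // sumr_ge0 // => i _; apply: sqr_ge0. Qed.

Lemma enorm_ge0 n (v : 'rV[R]_n) : 0 <= enorm v.
Proof. exact: sqrtr_ge0. Qed.

Lemma norm_le_enorm n (v : 'rV[R]_n) : `|v| <= enorm v.
Proof.
apply: norm_le; first exact: enorm_ge0.
move=> j; rewrite -(@ler_pXn2r _ 2) ?nnegrE ?enorm_ge0 // enorm_sqr.
rewrite real_normK ?num_real // (bigD1 j) //= lerDl.
by apply: sumr_ge0 => i _; apply: sqr_ge0.
Qed.

(** With [a] and [b] the norms of [u] and [v], the sum of the squares of [b u - a v] equals [2 a b]
    times the difference of the two sides. Vanishing norms are treated apart to allow the
    division. *)
Lemma cauchy_schwarz n (u v : 'rV[R]_n) :
  \sum_i u ord0 i * v ord0 i <= enorm u * enorm v.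
Proof.
have [v0|v0] := eqVneq (enorm v) 0.
  have vi i : v ord0 i = 0.
    apply/eqP; rewrite -normr_eq0 eq_le normr_ge0 andbT.
    by rewrite (le_trans (coord_le_norm _ _)) // -v0 norm_le_enorm.
  by rewrite v0 mulr0 big1 // => i _; rewrite vi mulr0.
have [u0|u0] := eqVneq (enorm u) 0.
  have ui i : u ord0 i = 0.
    apply/eqP; rewrite -normr_eq0 eq_le normr_ge0 andbT.
    by rewrite (le_trans (coord_le_norm _ _)) // -u0 norm_le_enorm.
  by rewrite u0 mul0r big1 // => i _; rewrite ui mul0r.
have a0 : 0 < enorm u by rewrite lt0r u0 enorm_ge0.
have b0 : 0 < enorm v by rewrite lt0r v0 enorm_ge0.
set a := enorm u in a0 *; set b := enorm v in b0 *.
have ab : 0 < a * b by rewrite mulr_gt0.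
have : 0 <= \sum_i (b * u ord0 i - a * v ord0 i) ^+ 2.
  by apply: sumr_ge0 => i _; apply: sqr_ge0.
have -> : \sum_i (b * u ord0 i - a * v ord0 i) ^+ 2 =
    b ^+ 2 * a ^+ 2 + a ^+ 2 * b ^+ 2 - 2 * (a * b) * \sum_i u ord0 i * v ord0 i.
  have ea : a ^+ 2 = \sum_i u ord0 i ^+ 2 := enorm_sqr u.
  have eb : b ^+ 2 = \sum_i v ord0 i ^+ 2 := enorm_sqr v.
  rewrite [in X in X + _ - _]ea [in X in _ + X - _]eb.
  rewrite !mulr_sumr -big_split /= -sumrB.
  by apply: eq_bigr => i _; ring.
have -> : b ^+ 2 * a ^+ 2 + a ^+ 2 * b ^+ 2 - 2 * (a * b) * \sum_i u ord0 i * v ord0 i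
   = 2 * (a * b) * (a * b - \sum_i u ord0 i * v ord0 i) by ring.
by rewrite pmulr_rge0 ?subr_ge0 // mulr_gt0.
Qed.

Lemma enorm_triangle n (u v : 'rV[R]_n) : enorm (u + v) <= enorm u + enorm v.
Proof.
rewrite -(@ler_pXn2r _ 2) ?nnegrE ?addr_ge0 ?enorm_ge0 //.
have := cauchy_schwarz u v; rewrite sqrrD !enorm_sqr.
under [X in _ -> X <= _]eq_bigr do rewrite mxE sqrrD.
rewrite !big_split /= => h; rewrite lerD2r lerD2l.
exact: (lerD h h).
Qed.

Lemma enorm_le n (v : 'rV[R]_n) : enorm v <= n%:R * `|v|.
Proof.
rewrite -(@ler_pXn2r _ 2) ?nnegrE ?mulr_ge0 ?enorm_ge0 // enorm_sqr.
apply: (@le_trans _ _ (\sum_(i < n) `|v| ^+ 2)).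
  apply: ler_sum => i _; rewrite -real_normK ?num_real //.
  by rewrite lerXn2r ?nnegrE ?coord_le_norm.
rewrite sumr_const card_ord exprMn -[leLHS]mulr_natl; apply: ler_wpM2r; first exact: exprn_ge0.
by rewrite -natrX ler_nat; case: n {v} => // n; rewrite expnS expn1 leq_pmull.
Qed.

Lemma eball_norm n (c x : 'rV[R]_n) r : eball c r x ->
  exists2 d, 0 < d & forall z, `|z - x| <= d -> eball c r z.
Proof.
rewrite /eball /= -subr_gt0; set g := r - _ => g0.
(* [enorm] is at most [n] times the sup norm; [n.+1] makes the final bound strict and covers
   [n = 0]. *)
exists (g / n.+1%:R); first by rewrite divr_gt0.
move=> z hz; rewrite -[z - c](subrK (x - c)) opprB [z - c + _]addrA subrK.
apply: le_lt_trans (enorm_triangle _ _) _; rewrite -ltrBrDr -/g.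
apply: le_lt_trans (enorm_le _) _.
apply: le_lt_trans (ler_wpM2l _ hz) _ => //.
by rewrite mulrCA gtr_pMr // ltr_pdivrMr // mul1r ltr_nat.
Qed.

End Norms.

(** * Right inverses along a slice *)

Section Slice.
Variables (R : realType) (m n : nat).
Variables (f : 'rV[R]_n -> 'rV[R]_m) (Df : 'rV[R]_n -> 'M[R]_(m, n)).
Variables (W : 'M[R]_(m, n)) (x0 : 'rV[R]_n) (s : R).
Hypothesis s0 : 0 < s.

(** The rows of [W] span the directions in which [x0] is moved. By the chain rule [slice_jac] is the
    transposed Jacobian of [f \o slice], acting on row vectors from the right. *)
Definition slice (t : 'rV[R]_m) : 'rV[R]_n := x0 + t *m W.
Definition slice_jac (t : 'rV[R]_m) : 'M[R]_m := W *m (Df (slice t))^T.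

Hypothesis hf : forall t : 'rV[R]_m, `|t| <= s -> differentiable f (slice t) /\
  forall h : 'rV[R]_n, 'd f (slice t) h = (Df (slice t) *m h^T)^T.
Hypothesis hW : forall t : 'rV[R]_m, `|t| <= s -> forall i j,
  `|(slice_jac t - 1%:M) i j| <= (2 * m.+1%:R)^-1.

Lemma slice_diff_le (t : 'rV[R]_m) : `|t| <= s -> forall e, 0 < e ->
  exists2 d, 0 < d & forall h, `|h| <= d ->
    `|f (slice (t + h)) - f (slice t) - h *m slice_jac t| <= e * `|h|.
Proof.
move=> ts e e0; have [df Df_eq] := hf ts.
have [K K0 hK] := norm_mulmx_bound W.
have [d d0 hd] := diff_le df (divr_gt0 e0 K0).
exists (d / K); first exact: divr_gt0.
move=> h; rewrite ler_pdivlMr // => hh.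
have le : `|h *m W| <= d by apply: le_trans hh.
have := hd _ le; rewrite Df_eq trmx_mul trmxK -mulmxA.
rewrite /slice mulmxDl addrA => /le_trans; apply.
by rewrite -mulrA ler_pM2l // ler_pdivrMl // mulrC.
Qed.

(** A column of [slice_jac t - 1] has [m] entries of size at most [1 / (2 (m + 1))]; this is the
    origin of the constant. *)
Lemma jac_near1 (t h : 'rV[R]_m) : `|t| <= s -> `|h *m (slice_jac t - 1%:M)| <= `|h| / 2.
Proof.
move=> ts; apply: norm_mulmx => // j.
apply: le_trans (_ : \sum_(i < m) (2 * m.+1%:R)^-1 <= _).
  by apply: ler_sum => i _; apply: hW.
rewrite sumr_const card_ord -[leLHS]mulr_natl invfM mulrCA ler_piMr //.
by rewrite ler_pdivrMr // mul1r ler_nat.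
Qed.

(** The mean value theorem for each coordinate of [u |-> f (slice (t' + u h)) - u h], whose
    derivative is [h (slice_jac - 1)]. The segment stays in the convex cube, and in the sup norm
    separate intermediate points for the coordinates do no harm. *)
Lemma slice_le (t t' : 'rV[R]_m) : `|t| <= s -> `|t'| <= s ->
  `|f (slice t) - f (slice t') - (t - t')| <= `|t - t'| / 2.
Proof.
move=> ts ts'; set h := t - t'.
apply: norm_le => [|j]; first by rewrite divr_ge0.
pose F (u : R) := f (slice (t' + u *: h)) - u *: h.
pose c (u : R) := (h *m (slice_jac (t' + u *: h) - 1%:M)).
have seg (u : R) : 0 <= u <= 1 -> `|t' + u *: h| <= s.
  move=> /andP[u0 u1].
  have -> : t' + u *: h = (1 - u) *: t' + u *: t.
    by apply/rowP => k; rewrite !mxE; ring.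
  apply: le_trans (ler_normD _ _) _; rewrite !normrZ ger0_norm ?subr_ge0 //.
  rewrite [`|u|]ger0_norm //.
  apply: le_trans (_ : (1 - u) * s + u * s <= _).
    by rewrite lerD // ler_wpM2l // subr_ge0.
  by rewrite -mulrDl subrK mul1r.
have dF (u : R) : 0 <= u <= 1 -> is_derive u 1 (fun u => F u ord0 j : R) (c u ord0 j).
  move=> hu; have hs := seg _ hu.
  have [||dd de] := @le_diff R R R (fun u => F u ord0 j) u ( *:%R (c u ord0 j)).
  - exact: scaler_continuous.
  (* Errors relative to [k *: h] become errors relative to [k]; [1 + |h|] is a divisor that cannot
     vanish. *)
  - move=> e e0; have h1 : 0 < 1 + `|h| by rewrite ltr_pwDl.
    have [d d0 hd] := slice_diff_le hs (divr_gt0 e0 h1).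
    exists (d / (1 + `|h|)); first exact: divr_gt0.
    move=> k; rewrite ler_pdivlMr // => hk.
    have le : `|k *: h| <= d.
      rewrite normrZ; apply: le_trans hk.
      by rewrite ler_wpM2l // lerDr.
    have -> : F (u + k) ord0 j - F u ord0 j - c u ord0 j *: k =
       (f (slice (t' + u *: h + k *: h)) - f (slice (t' + u *: h)) -
         (k *: h) *m slice_jac (t' + u *: h)) ord0 j.
      rewrite /F /c mulmxBr mulmx1 scalerDl addrA -scalemxAl !mxE /=.
      by rewrite /GRing.scale /= mulrC; ring.
    apply: le_trans (coord_le_norm _ _) _; apply: le_trans (hd _ le) _.
    rewrite normrZ mulrAC -mulrA ler_wpM2l ?(ltW e0) // ler_pdivrMr //.
    by rewrite ler_wpM2l // lerDr.
  split; first exact: diff_derivable.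
  by rewrite deriveE // de; apply: mulr1.
have [|u|c0 hc] := @MVT R (fun u => F u ord0 j) (fun u => c u ord0 j) 0 1 ltr01.
- by move=> u; rewrite in_itv /= => /andP[a b]; apply: dF; rewrite !ltW.
- apply: derivable_within_continuous => v; rewrite in_itv /= => /dF hv.
  exact: ex_derive.
rewrite subr0 mulr1 => e.
have -> : (f (slice t) - f (slice t') - h) ord0 j = c c0 ord0 j.
  rewrite -e /F scale1r scale0r addr0 subr0 [t' + h]addrC subrK !mxE; ring.
have hs : `|t' + c0 *: h| <= s.
  by apply: seg; move: hc; rewrite in_itv /= => /andP[a b]; rewrite !ltW.
exact: le_trans (coord_le_norm _ _) (jac_near1 _ hs).
Qed.

Lemma slice_expand (t t' : 'rV[R]_m) : `|t| <= s -> `|t'| <= s ->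
  `|t - t'| <= 2 * `|f (slice t) - f (slice t')|.
Proof.
move=> ts ts'; have h := slice_le ts ts'.
have := ler_normB (f (slice t) - f (slice t')) (f (slice t) - f (slice t') - (t - t')).
rewrite subKr; lra.
Qed.

Lemma slice_lip (t t' : 'rV[R]_m) : `|t| <= s -> `|t'| <= s ->
  `|f (slice t) - f (slice t')| <= 2 * `|t - t'|.
Proof.
move=> ts ts'; have h := slice_le ts ts'.
have := ler_normD (f (slice t) - f (slice t') - (t - t')) (t - t').
rewrite subrK; have := normr_ge0 (t - t'); lra.
Qed.

Lemma slice0 : slice 0 = x0.
Proof. by rewrite /slice mul0mx addr0. Qed.

Lemma slice_continuous (t : 'rV[R]_m) : `|t| <= s -> {for t, continuous (f \o slice)}.
Proof.
move=> ts; have [K K0 hK] := norm_mulmx_bound (slice_jac t).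
have [d d0 hd] := slice_diff_le ts ltr01.
apply: le_continuous => e e0.
have e1 : 0 < e / (1 + K) by rewrite divr_gt0 // addr_gt0.
exists (Num.min d (e / (1 + K))); first by rewrite lt_min d0.
move=> u; rewrite le_min => /andP[h1 h2].
have eu : t + (u - t) = u by rewrite addrC subrK.
have := hd (u - t); rewrite distrC => /(_ h1); rewrite eu mul1r => h.
have hk : `|(u - t) *m slice_jac t| <= `|t - u| * K by rewrite [`|t - u|]distrC.
have := ler_normD (f (slice u) - f (slice t) - (u - t) *m slice_jac t)
  ((u - t) *m slice_jac t); rewrite subrK [leLHS]distrC /= => /le_trans; apply.
move: h2; rewrite ler_pdivlMr ?addr_gt0 // mulrDr mulr1 => h2.
by apply: le_trans h2; apply: lerD.
Qed.

(** The competitor [t - r], with [r] the residual, is the sum of [y - f x0] and minus the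
    linearisation error between 0 and [t]. Both have norm at most [s / 2], so it stays in the cube
    even for a minimiser on the boundary. Its own residual is at most [|r| / 2], whence [r = 0]. *)
Lemma slice_onto (y : 'rV[R]_m) : `|y - f x0| <= s / 2 ->
  exists2 t : 'rV[R]_m, `|t| <= s & f (slice t) = y.
Proof.
move=> hy; pose A := [set t : 'rV[R]_m | `|t| <= s].
have A0 : A 0 by rewrite /A /= normr0 ltW.
have cA : compact A.
  apply: bounded_closed_compact.
    by exists s; split; [apply: num_real|move=> u su v hv; apply: le_trans hv (ltW su)].
  have -> : A = closed_ball_ (fun x => `|x|) 0 s.
    by apply/seteqP; split => v; rewrite /A /closed_ball_ /= sub0r normrN.
  exact: closed_closed_ball_.
have [||t] := @EVT_min_rV R m (fun t => `|f (slice t) - y|) A _ cA.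
- by exists 0.
- apply: continuous_in_subspaceT => t; rewrite inE => ts.
  apply: le_continuous => e e0.
  have [d d0 hd] := continuous_le (slice_continuous ts) e0.
  exists d => // u /hd; apply: le_trans; apply: le_trans (ler_dist_dist _ _) _.
  by rewrite opprB addrA subrK.
rewrite inE => ts hmin; exists t => //.
set r := f (slice t) - y in hmin *.
have hr : `|t - r| <= s.
  have := slice_le ts A0; rewrite slice0 subr0 => h.
  have -> : t - r = - (f (slice t) - f x0 - t) + (y - f x0).
    by apply/rowP => j; rewrite /r !mxE; ring.
  apply: le_trans (ler_normD _ _) _; rewrite normrN.
  rewrite [s]splitr; apply: lerD hy; apply: le_trans h _.
  by rewrite ler_pM2r.
have := hmin (t - r); rewrite inE => /(_ hr).
have := slice_le hr ts.
have -> : f (slice (t - r)) - f (slice t) - (t - r - t) = f (slice (t - r)) - y.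
  by apply/rowP => j; rewrite /r !mxE; ring.
have -> : t - r - t = - r by rewrite addrAC subrr add0r.
rewrite normrN -/r => h1 h2.
have r0 : `|r| <= 0 by have := le_trans h2 h1; lra.
by apply/eqP; rewrite -subr_eq0 -/r -normr_le0.
Qed.

Lemma jac_expand (t h : 'rV[R]_m) : `|t| <= s -> `|h| <= 2 * `|h *m slice_jac t|.
Proof.
move=> /(jac_near1 h); rewrite mulmxBr mulmx1 => H.
have := ler_normB (h *m slice_jac t) (h *m slice_jac t - h).
rewrite subKr; lra.
Qed.

Lemma jac_unit (t : 'rV[R]_m) : `|t| <= s -> slice_jac t \in unitmx.
Proof.
move=> ts; rewrite -row_free_unit; apply: inj_row_free => h h0.
have := jac_expand h ts; rewrite h0 normr0 mulr0 => H.
by apply/eqP; rewrite -normr_le0.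
Qed.

Lemma jac_inv_le (t h : 'rV[R]_m) : `|t| <= s ->
  `|h *m invmx (slice_jac t)| <= 2 * `|h|.
Proof.
by move=> ts; apply: le_trans (jac_expand _ ts) _; rewrite mulmxKV ?jac_unit.
Qed.

(** * Regularity of the section defined by a local inverse *)

Section Inverse.
Variables (D : set 'rV[R]_m) (inv : 'rV[R]_m -> 'rV[R]_m).
Hypothesis oD : forall y, D y -> exists2 d, 0 < d & forall z, `|z - y| <= d -> D z.
Hypothesis hinv : forall y, D y -> `|inv y| <= s /\ f (slice (inv y)) = y.

Definition section_der (y : 'rV[R]_m) : 'M[R]_(n, m) :=
  (invmx (slice_jac (inv y)) *m W)^T.

Lemma inv_lip y z : D y -> D z -> `|inv z - inv y| <= 2 * `|z - y|.
Proof.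
move=> /hinv[ys ye] /hinv[zs ze]; have := slice_expand zs ys.
by rewrite ye ze.
Qed.

(** With [u] the increment of [inv] and [J] the transposed Jacobian, the remainder of the section is
    [- (h - u J) J^-1 W], and [h - u J] is the remainder of the slice map at [inv y]. It is small
    relative to [u], hence to [h], as [inv] is Lipschitz. *)
Lemma section_diff y : D y -> differentiable (slice \o inv) y /\
  forall h, 'd (slice \o inv) y h = (section_der y *m h^T)^T.
Proof.
move=> Dy; have [d d0 hd] := oD Dy; have [ys ye] := hinv Dy.
have [K K0 hK] := norm_mulmx_bound W.
set J := slice_jac (inv y).
have [|e e0|dg eg] := @le_diff R _ _ (slice \o inv) y (mulmxr (invmx J *m W)).
- exact: continuous_mulmxr.
(* The factor [4 K] combines the Lipschitz constant 2 of [inv], the bound 2 for [J^-1] and the bound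
   [K] for [W]. *)
- have e1 : 0 < e / (4 * K) by rewrite divr_gt0 // mulr_gt0.
  have [d' d'0 hd'] := slice_diff_le ys e1.
  exists (Num.min d (d' / 2)); first by rewrite lt_min d0 divr_gt0.
  move=> h; rewrite le_min => /andP[h1 h2].
  have Dyh : D (y + h) by apply: hd; rewrite addrC addrA addNr add0r.
  have [zs ze] := hinv Dyh.
  pose u := inv (y + h) - inv y.
  have lu : `|u| <= 2 * `|h|.
    by have := inv_lip Dy Dyh; rewrite addrAC subrr add0r.
  have eu : inv y + u = inv (y + h) by rewrite /u addrC subrK.
  have := hd' u; rewrite eu ze ye [y + h]addrC addrK -/J.
  have le : `|u| <= d' by move: lu h2; rewrite ler_pdivlMr //; lra.
  move=> /(_ le) h3 /=.
  have -> : slice (inv (h + y)) - slice (inv y) - h *m (invmx J *m W) =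
      - ((h - u *m J) *m invmx J *m W).
    rewrite /slice opprD addrACA subrr add0r -mulmxBl [h + y]addrC -/u.
    rewrite [(h - _) *m _]mulmxBl mulmxK ?jac_unit //.
    by rewrite [(_ - u) *m _]mulmxBl opprB mulmxA.
  rewrite normrN; apply: le_trans (hK _) _.
  have h4 := jac_inv_le (h - u *m J) ys.
  have h5 : `|(h - u *m J) *m invmx J| <= e / K * `|h|.
    apply: le_trans h4 _; have h5 : e / (4 * K) * `|u| <= e / (4 * K) * (2 * `|h|).
      by rewrite ler_pM2l.
    have -> : e / K * `|h| = 2 * (e / (4 * K) * (2 * `|h|)).
      by field; rewrite gt_eqF.
    by rewrite ler_pM2l //; apply: le_trans h3 h5.
  have -> : e * `|h| = e / K * `|h| * K by field; rewrite gt_eqF.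
  by rewrite ler_pM2r.
split=> // h; rewrite eg /section_der -/J /=.
by rewrite [RHS]trmx_mul !trmxK.
Qed.

(** This uniform bound fixes the number of guard bits in [cmx_inv_mulmx]. *)
Lemma section_der_bound : exists2 K, 0 < K & forall y, D y ->
  forall i j, `|section_der y i j| <= K.
Proof.
have [K K0 hK] := norm_mulmx_bound W.
exists (2 * K); first exact: mulr_gt0.
move=> y /hinv[ys _] i j; rewrite mxE.
have -> : (invmx (slice_jac (inv y)) *m W) j i =
    ((delta_mx 0 j : 'rV[R]_m) *m invmx (slice_jac (inv y)) *m W) ord0 i.
  by rewrite -mulmxA -rowE !mxE.
apply: le_trans (coord_le_norm _ _) _; apply: le_trans (hK _) _.
rewrite ler_pM2r //; apply: le_trans (jac_inv_le _ ys) _.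
rewrite ler_piMr //; apply: norm_le => // k; rewrite mxE /=.
by case: (_ == _); rewrite ?normr0 ?normr1.
Qed.

Hypothesis hcont : forall t : 'rV[R]_m, `|t| <= s -> {for slice t, continuous Df}.

(** Rests on [Jy^-1 - Jz^-1 = Jy^-1 (Jz - Jy) Jz^-1], read row by row through unit vectors. *)
Lemma section_der_continuous y : D y -> {for y, continuous section_der}.
Proof.
move=> Dy; have [d d0 hd] := oD Dy; have [ys ye] := hinv Dy.
have [K K0 hK] := norm_mulmx_bound W.
apply: le_continuous => e e0.
have n0 : 0 < n.+1%:R :> R by [].
(* Both inverses contribute 2, and [W] contributes [K] twice, inside [Jz - Jy] and at the end;
   [n.+1] bounds the column sums of the difference of the derivatives. *)
have e1 : 0 < e / (4 * K * K * n.+1%:R) by rewrite divr_gt0 // !mulr_gt0.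
have [d' d'0 hd'] := continuous_le (hcont ys) e1.
exists (Num.min d (d' / (2 * K))).
  by rewrite lt_min d0 divr_gt0 // mulr_gt0.
move=> z; rewrite le_min => /andP[h1 h2].
have Dz : D z by apply: hd; rewrite distrC.
have [zs ze] := hinv Dz.
have hD : `|Df (slice (inv y)) - Df (slice (inv z))| <= e / (4 * K * K * n.+1%:R).
  apply: hd'; rewrite /slice opprD addrACA subrr add0r -mulmxBl.
  apply: le_trans (hK _) _; move: h2; rewrite ler_pdivlMr ?mulr_gt0 // => h2.
  apply: le_trans h2; rewrite mulrA [_ * 2]mulrC ler_pM2r //.
  exact: inv_lip.
set eta := e / _ in hD e1.
have q0 : 0 < n.+1%:R * eta by exact: mulr_gt0.
set Jy := slice_jac (inv y); set Jz := slice_jac (inv z).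
have E : invmx Jy *m (Jz - Jy) *m invmx Jz = invmx Jy - invmx Jz.
  by rewrite mulmxBr mulVmx ?jac_unit // mulmxBl mul1mx mulmxK ?jac_unit.
apply: mx_norm_le (ltW e0) _ => i j.
set a := (delta_mx 0 j : 'rV[R]_m) *m invmx Jy.
have -> : (section_der y - section_der z) i j =
    (a *m (Jz - Jy) *m invmx Jz *m W) ord0 i.
  rewrite /a -!mulmxA [invmx Jy *m _]mulmxA [_ *m (invmx Jz *m W)]mulmxA E.
  by rewrite -rowE /section_der -/Jy -/Jz mulmxBl !mxE.
have ha : `|a| <= 2.
  apply: le_trans (jac_inv_le _ ys) _.
  rewrite ler_piMr //; apply: norm_le => // k; rewrite mxE /=.
  by case: (_ == _); rewrite ?normr0 ?normr1.
have hw : `|a *m (Jz - Jy)| <= `|a| * K * (n.+1%:R * eta).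
  have -> : a *m (Jz - Jy) = a *m W *m (Df (slice (inv z)) - Df (slice (inv y)))^T.
    by rewrite /Jz /Jy /slice_jac -mulmxBr -raddfB mulmxA.
  apply: le_trans (norm_mulmx (e := n.+1%:R * eta) _ _ _) _.
  - exact: ltW.
  - move=> k; apply: le_trans (_ : \sum_(l < n) eta <= _).
      apply: ler_sum => l _; apply: le_trans hD.
      by rewrite distrC mxE; apply: mx_coord_le_norm.
    by rewrite sumr_const card_ord -[leLHS]mulr_natl ler_pM2r // ler_nat.
  - by rewrite (ler_pM2r q0).
apply: le_trans (coord_le_norm _ _) _; apply: le_trans (hK _) _.
have h3 := jac_inv_le (a *m (Jz - Jy)) zs.
have -> : e = 2 * (2 * K * (n.+1%:R * eta)) * K.
  by rewrite /eta; field; rewrite !gt_eqF.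
rewrite ler_pM2r //; apply: le_trans h3 _; rewrite ler_pM2l //.
apply: le_trans hw _; rewrite (ler_pM2r q0).
by rewrite ler_pM2r.
Qed.

End Inverse.
End Slice.

(** * Rational approximation of matrices and of their inverses *)

Definition qmx (R : realType) m n (c : 'I_m -> 'I_n -> nat) : 'M[R]_(m, n) :=
  \matrix_(i, j) qdec (c i j).
Arguments qmx R {m n} c.

Section Approximation.
Variable R : realType.

Lemma mulmx_ler m n k (A : 'M[R]_(m, n)) (B : 'M[R]_(n, k)) i j e :
  (forall l, `|B l j| <= e) -> `|(A *m B) i j| <= (\sum_l `|A i l|) * e.
Proof.
move=> h; rewrite mxE mulr_suml; apply: le_trans (ler_norm_sum _ _ _) _.
by apply: ler_sum => l _; rewrite normrM ler_wpM2l.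
Qed.

Lemma mulmx_lel m n k (A : 'M[R]_(m, n)) (B : 'M[R]_(n, k)) i j e :
  (forall l, `|A i l| <= e) -> `|(A *m B) i j| <= e * \sum_l `|B l j|.
Proof.
move=> h; rewrite mxE mulr_sumr; apply: le_trans (ler_norm_sum _ _ _) _.
by apply: ler_sum => l _; rewrite normrM ler_wpM2r.
Qed.

Lemma rational_mx_dense m n (A : 'M[R]_(m, n)) e : 0 < e ->
  exists c : 'I_m -> 'I_n -> nat, forall i j, `|A i j - qdec (c i j)| < e.
Proof.
move=> e0; exists (fun i j => projT1 (cid (qdec_dense (A i j) e0))) => i j.
exact: (projT2 (cid (qdec_dense (A i j) e0))).
Qed.

Lemma rational_qmx m n (c : 'I_m -> 'I_n -> nat) : rational_mx (qmx R c).
Proof. by move=> i j; exists (c i j); rewrite mxE. Qed.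

Lemma scale_lt (S e : R) : 0 <= S -> 0 < e -> exists2 d, 0 < d & S * d <= e.
Proof.
move=> S0 e0; have h : 0 < S + 1 by rewrite ltr_wpDl.
exists (e / (S + 1)); first exact: divr_gt0.
by rewrite mulrA ler_pdivrMr // mulrC ler_pM2l // lerDl.
Qed.

Lemma sum_norm_ge0 (I : finType) (F : I -> R) : 0 <= \sum_i `|F i|.
Proof. by apply: sumr_ge0. Qed.

Lemma row_sum_le m n (A : 'M[R]_(m, n)) i :
  \sum_j `|A i j| <= \sum_i \sum_j `|A i j|.
Proof.
rewrite [leRHS](bigD1 i) //= lerDl; apply: sumr_ge0 => k _; exact: sumr_ge0.
Qed.

Lemma total_sum_ge0 m n (A : 'M[R]_(m, n)) : 0 <= \sum_i \sum_j `|A i j|.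
Proof. by apply: sumr_ge0 => i _; apply: sumr_ge0. Qed.

(** Full row rank gives [A *m B = 1], so [B^T] satisfies the condition exactly and a rational matrix
    close to it satisfies it up to [e]. *)
Lemma rational_right_inverse m n (A : 'M[R]_(m, n)) e : \rank A = m -> 0 < e ->
  exists c : 'I_m -> 'I_n -> nat, forall i j,
    `|(qmx R c *m A^T - 1%:M) i j| <= e.
Proof.
move=> rA e0; have /row_freeP[B hB] : row_free A by rewrite /row_free rA.
have [d d0 hd] := scale_lt (total_sum_ge0 A) e0.
have [c hc] := rational_mx_dense B^T d0.
exists c => i j.
have -> : qmx R c *m A^T - 1%:M = (A *m (qmx R c - B^T)^T)^T.
  by rewrite trmx_mul trmxK mulmxBl -trmx_mul hB trmx1.
rewrite mxE; apply: le_trans hd.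
apply: (@le_trans _ _ ((\sum_l `|A j l|) * d)).
  apply: mulmx_ler => l; have := hc i l.
  by rewrite !mxE distrC => /ltW.
by rewrite ler_wpM2r ?row_sum_le // ltW.
Qed.

Lemma theta_nbhs n p (U : set 'rV[R]_n) x : theta p U -> U x ->
  exists2 d, 0 < d & forall z, `|z - x| <= d -> U z.
Proof.
move=> -> [j _ /eball_norm [d d0 hd]]; exists d => // z /hd hz.
by exists j.
Qed.

(** Half of the tolerance pays for the rational approximation at [x0], the other half for the
    variation of [Df] on the cube. *)
Lemma good_slice n m (U : set 'rV[R]_n) (Df : 'rV[R]_n -> 'M[R]_(m, n)) x0 :
  (exists2 d, 0 < d & forall z, `|z - x0| <= d -> U z) ->
  {for x0, continuous Df} -> \rank (Df x0) = m ->
  exists (c : 'I_m -> 'I_n -> nat) k, forall t : 'rV[R]_m, `|t| <= 2 ^- k ->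
    U (slice (qmx R c) x0 t) /\
    forall i j, `|(slice_jac Df (qmx R c) x0 t - 1%:M) i j| <= (2 * m.+1%:R)^-1.
Proof.
move=> [d d0 hd] cDf rk.
have e0 : 0 < (2 * m.+1%:R)^-1 / 2 :> R by rewrite divr_gt0 // invr_gt0 mulr_gt0.
have [c hc] := rational_right_inverse rk e0.
set W := qmx R c in hc.
have [h h0 hh] := scale_lt (total_sum_ge0 W) e0.
have [d' d'0 hd'] := continuous_le cDf h0.
have [K K0 hK] := norm_mulmx_bound W.
have [|k hk] := @pow2_lt R (Num.min d d' / K).
  by rewrite divr_gt0 // lt_min d0.
exists c, k => t ht.
have ht' : `|t *m W| <= Num.min d d'.
  apply: le_trans (hK _) _; rewrite -ler_pdivlMr //.
  exact: le_trans ht (ltW hk).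
move: ht'; rewrite le_min => /andP[h1 h2]; split.
  by apply: hd; rewrite /slice addrAC subrr add0r.
move=> i j; rewrite /slice_jac -/W.
have -> : W *m (Df (slice W x0 t))^T - 1%:M =
   (W *m (Df x0)^T - 1%:M) + W *m (Df (slice W x0 t) - Df x0)^T.
  by rewrite raddfB mulmxBr [RHS]addrC addrA subrK.
rewrite mxE; apply: le_trans (ler_normD _ _) _.
rewrite [leRHS]splitr; apply: lerD => //; apply: le_trans hh.
apply: (@le_trans _ _ ((\sum_l `|W i l|) * h)); last first.
  by rewrite ler_wpM2r ?row_sum_le // ltW.
apply: mulmx_ler => l; have := hd' (slice W x0 t).
rewrite /slice opprD addrA subrr add0r normrN => /(_ h2); apply: le_trans.
by rewrite distrC mxE; apply: mx_coord_le_norm.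
Qed.

Lemma cq_mulmx P m n k (A : 'I_m -> 'I_n -> fn R) (B : 'I_n -> 'I_k -> fn R) i j :
  (forall i j, cq P (A i j)) -> (forall i j, cq P (B i j)) ->
  cq P (fun o v => \sum_l A i l o v * B l j o v).
Proof. by move=> hA hB; apply: cq_sum => l; apply: cq_mul. Qed.

(** If [Q] is within [2 ^- b] of [J], the term [2 ^- b * \sum |M|] bounds [M (J - Q)], so the test
    on [M Q - 1] controls [M J - 1]. The error of the output is then
    [J^-1 W - M W = - (M J - 1) (J^-1 W)]. *)
Lemma cmx_inv_mulmx s P m n (J : fn 'M[R]_m) (W : 'M[R]_(m, n)) (K : R) :
  sized s P -> rational_mx W -> cmx P J ->
  (forall o v, P o v -> J o v \in unitmx) ->
  (forall o v, P o v -> forall i j, `|(invmx (J o v) *m W) i j| <= K) ->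
  cmx P (fun o v => invmx (J o v) *m W).
Proof.
move=> s1 rW cJ uJ hK; have s2 := sized_push s1; have s3 := sized_push s2.
(* An entry of [(M J - 1) (J^-1 W)] sums [m] terms with right factor at most [K]; [c] guard bits
   compensate for [m K]. *)
have [c hc] := pow2_ge (m%:R * K).
have c2 := cmx_push s2 (cmx_push s1 cJ).
(* The precision [b] at which [J] is read belongs to the candidate, because it depends on the size
   of [M]. *)
pose b : fn nat := fun _ w => (cunpair (nth 0%N w 0)).1.
pose M i l : fn R := fun _ w =>
  qdec (untuple (cunpair (nth 0%N w 0)).2 (cpair (i : 'I_m) (l : 'I_m))).
have cM i l : cq (push (push P)) (M i l).
  by apply: cq_qdec; apply: cf_untuple; apply: cf_snd; apply: cf_proj.
have cb_ : cf (push (push P)) b by apply: cf_fst; apply: cf_proj.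
have [Q [cQ hQ]] := cmx_approx s3 c2 cb_.
pose T : fn bool := fun o w => [forall i, [forall j,
  `|(\sum_l M i l o w * Q l j o w) - (i == j)%:R| + 2 ^- b o w * \sum_l `|M i l o w|
   <= 2 ^- (nth 0%N w 1 + c)]].
pose MM o w : 'M[R]_m := \matrix_(i, l) M i l o w.
pose QQ o w : 'M[R]_m := \matrix_(i, l) Q i l o w.
have TE o w : T o w = [forall i, [forall j, `|(MM o w *m QQ o w - 1%:M) i j| +
    2 ^- b o w * \sum_l `|MM o w i l| <= 2 ^- (nth 0%N w 1 + c)]].
  apply: eq_forallb => i; apply: eq_forallb => j; rewrite !mxE.
  under [in RHS]eq_bigr do rewrite !mxE.
  by under [in X in _ = (_ + _ * X <= _)]eq_bigr do rewrite mxE.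
apply: (cmx_search s1 (T := T) (Q := fun i j o w => \sum_l M i l o w * W l j)).
- apply: cb_all => i; apply: cb_all => j; apply: cb_ler.
    apply: cq_add; last first.
      by apply: cq_mul; [apply: cq_pow2|apply: cq_sum => l; apply: cq_norm].
    by apply: cq_norm; apply: cq_subr; [apply: cq_mulmx|apply: cq_natc].
  by apply: cq_pow2; exact: (cf_addn (cf_proj _ 1) (cf_const _ c)).
- by move=> i j; apply: cq_sum => l; apply: cq_mul; [exact: cM|exact: cq_rational_mx].
- move=> o v a hv; have u := uJ _ _ hv; set A := J o v in u *.
  have e0 := pow2_gt0 R (a + c); set ee := 2 ^- (a + c) in e0 *.
  have e4 : 0 < ee / 4 by rewrite divr_gt0.
  (* Three contributions get a quarter of the tolerance each: [M A - 1], [M (Q - A)] and the error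
     term of the test. *)
  have [d d0 hd] := scale_lt (total_sum_ge0 A^T) e4.
  have [q hq] := rational_mx_dense (invmx A) d0.
  have [h h0 hh] := scale_lt (total_sum_ge0 (qmx R q)) e4.
  have [B hB] := pow2_lt h0.
  pose F x := if (insub (cunpair x).1, insub (cunpair x).2) is (Some i, Some l)
    then q i l else 0%N.
  have [e' he'] := untuple_onto F (cpair m m).
  exists (cpair B e'); rewrite TE; apply/forallP => i; apply/forallP => j.
  set w := [:: _, a & v].
  have eM : MM o w = qmx R q.
    apply/matrixP => i' l; rewrite !mxE /M /= cunpair_cpair /= he' ?/F.
      by rewrite cunpair_cpair /= !valK.
    exact: ltn_cpair.
  have eb : b o w = B by rewrite /b /= cunpair_cpair.
  rewrite eM eb.
  have hrow : \sum_l `|qmx R q i l| * 2 ^- B <= ee / 4.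
    rewrite -mulr_suml; apply: le_trans hh; apply: ler_pM => //.
    - exact: sum_norm_ge0.
    - exact: row_sum_le.
    - exact: ltW.
  have h1 : `|(qmx R q *m A - 1%:M) i j| <= ee / 4.
    rewrite -(mulVmx u) -mulmxBl; apply: le_trans hd.
    apply: (@le_trans _ _ (d * \sum_l `|A l j|)).
      by apply: mulmx_lel => l; have := hq i l; rewrite !mxE distrC => /ltW.
    rewrite mulrC ler_wpM2r ?(ltW d0) //; apply: le_trans (row_sum_le A^T j).
    by apply: ler_sum => l _; rewrite mxE.
  have h2 : `|(qmx R q *m (QQ o w - A)) i j| <= ee / 4.
    apply: le_trans hrow; rewrite -mulr_suml; apply: mulmx_ler => l.
    by have := hQ o w hv l j; rewrite eb !mxE distrC.
  have -> : qmx R q *m QQ o w - 1%:M = (qmx R q *m A - 1%:M) + qmx R q *m (QQ o w - A).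
    by rewrite mulmxBr [RHS]addrC addrA subrK.
  have h3 : 2 ^- B * \sum_l `|qmx R q i l| <= ee / 4.
    by rewrite mulrC mulr_suml.
  rewrite mxE; have := ler_normD ((qmx R q *m A - 1%:M) i j) ((qmx R q *m (QQ o w - A)) i j).
  rewrite /= -/ee; lra.
- move=> o v a e hv; rewrite TE => /forallP hT i j.
  have u := uJ _ _ hv; have hKv := hK _ _ hv; set A := J o v in u hKv *; set w := [:: e, a & v] in hT *.
  have -> : (invmx A *m W) i j - \sum_l M i l o w * W l j =
      - ((MM o w *m A - 1%:M) *m (invmx A *m W)) i j.
    rewrite mulmxBl mul1mx mulmxA mulmxK // !mxE opprB.
    by congr (_ - _); apply: eq_bigr => l _; rewrite mxE.
  rewrite normrN.
  apply: (@le_trans _ _ (2 ^- (a + c) * \sum_(l < m) K)).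
    apply: (@le_trans _ _ (2 ^- (a + c) * \sum_l `|(invmx A *m W) l j|)).
      apply: mulmx_lel => l; have /forallP /(_ l) := hT i; apply: le_trans.
      have -> : MM o w *m A - 1%:M = (MM o w *m QQ o w - 1%:M) + MM o w *m (A - QQ o w).
        by rewrite mulmxBr [RHS]addrC addrA subrK.
      rewrite mxE; apply: le_trans (ler_normD _ _) _; apply: lerD => //.
      rewrite mulrC; apply: mulmx_ler => l'.
      by have := hQ o w hv l' l; rewrite !mxE.
    rewrite ler_wpM2l ?(ltW (pow2_gt0 _ _)) //; apply: ler_sum => l _; exact: hKv.
  rewrite sumr_const card_ord pow2D -mulrA ler_piMr ?(ltW (pow2_gt0 _ _)) //.
  by rewrite -[K *+ m]mulr_natl ler_pdivrMl ?exprn_gt0 // mulr1.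
Qed.

End Approximation.

(** * Computing the local section and its derivative *)

Section LocalSection.
Variables (R : realType) (n m : nat) (U : set 'rV[R]_n).
Variables (f : 'rV[R]_n -> 'rV[R]_m) (Df : 'rV[R]_n -> 'M[R]_(m, n)) (x0 : 'rV[R]_n).
Hypotheses (cpf : computable_on U f) (C1 : C1_with_derivative U f Df).
Hypotheses (cpDf : computable_on U Df) (cpx0 : computable_vec x0).
Variables (W : 'M[R]_(m, n)) (k : nat).
Hypothesis rW : rational_mx W.
Hypothesis hU : forall t : 'rV[R]_m, `|t| <= 2 ^- k -> U (slice W x0 t).
Hypothesis hW : forall t : 'rV[R]_m, `|t| <= 2 ^- k ->
  forall i j, `|(slice_jac Df W x0 t - 1%:M) i j| <= (2 * m.+1%:R)^-1.

Let hf (t : 'rV[R]_m) : `|t| <= 2 ^- k -> differentiable f (slice W x0 t) /\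
  forall h : 'rV[R]_n, 'd f (slice W x0 t) h = (Df (slice W x0 t) *m h^T)^T.
Proof. by move=> /hU /C1[]. Qed.

Let s0 : 0 < 2 ^- k :> R := pow2_gt0 R k.
(** Half the size of the cube, as [slice_onto] demands. *)
Let D : set 'rV[R]_m := eball (f x0) (2 ^- k.+1).
Let inv (y : 'rV[R]_m) : 'rV[R]_m :=
  xget 0 [set t | `|t| <= 2 ^- k /\ f (slice W x0 t) = y].

Let D_lt y : D y -> `|y - f x0| < 2 ^- k / 2.
Proof. by move=> h; rewrite -pow2_half; apply: le_lt_trans (norm_le_enorm _) h. Qed.

Let hinv y : D y -> `|inv y| <= 2 ^- k /\ f (slice W x0 (inv y)) = y.
Proof.
move=> /D_lt/ltW /(slice_onto s0 hf hW)[t ts te].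
by rewrite /inv; case: xgetP => // /(_ t) /(_ (conj ts te)).
Qed.

(** Strictness, inherited from the open ball, leaves room for rational points of the cube around
    [inv y]. *)
Let inv_lt y : D y -> `|inv y| < 2 ^- k.
Proof.
move=> Dy; have [h1 h2] := hinv Dy.
have h0 : `|0 : 'rV[R]_m| <= 2 ^- k by rewrite normr0 ltW.
have := slice_expand hf hW h1 h0; rewrite subr0 h2 slice0 => /le_lt_trans; apply.
by have := D_lt Dy; lra.
Qed.

(** Coordinates that are too large become 0, so every code denotes a point of the cube and the
    machine of [f] may safely be run on it. *)
Let trial (e : nat) : 'rV[R]_m :=
  \row_i (if `|qdec (untuple e i) : R| <= 2 ^- k then qdec (untuple e i) else 0).

Let trial_le e : `|trial e| <= 2 ^- k.
Proof.
apply: norm_le => [|j]; first exact: ltW.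
by rewrite mxE; case: ifP => // _; rewrite normr0 ltW.
Qed.

Let trial_dense y d : D y -> 0 < d -> exists e, `|trial e - inv y| <= d.
Proof.
move=> Dy d0; have lt := inv_lt Dy.
have g0 : 0 < Num.min d (2 ^- k - `|inv y|) by rewrite lt_min d0 subr_gt0.
have [c hc] := rational_mx_dense (inv y) g0.
have [e he] := untuple_onto (fun i => if insub i is Some j then c ord0 j else 0%N) m.
exists e; apply: norm_le => [|j]; first exact: ltW.
have := hc ord0 j; rewrite lt_min => /andP[h1 h2].
rewrite !mxE he // valK ifT; first by rewrite distrC ltW.
have := ler_normB (inv y ord0 j) (inv y ord0 j - qdec (c ord0 j)).
rewrite subKr => /le_trans; apply; have := coord_le_norm (inv y) j; lra.
Qed.

Let cmx_slice s P (T : fn 'rV[R]_m) : sized s P -> cmx P T ->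
  cmx P (fun o v => slice W x0 (T o v)).
Proof.
move=> hs hT; apply: (cmx_add hs); first exact: cmx_computable_vec hs cpx0.
exact: cmx_mulmxr hs _ _ _ _ _ rW hT.
Qed.

Let cq_trial P i j : cq P (fun _ w => trial (nth 0%N w 0) i j).
Proof.
have cq1 : cq P (fun _ w => qdec (untuple (nth 0%N w 0) j) : R).
  by apply: cq_qdec; apply: cf_untuple; apply: cf_proj.
apply: cq_ext (cq_if _ cq1 (cq_natc _ _ 0)) _ => [|o v _].
  exact: cb_ler (cq_norm cq1) (cq_pow2 _ (cf_const _ k)).
by rewrite mxE.
Qed.

(** The residual is read up to [2 ^- (a + 3)] and must appear to be at most [2 ^- (a + 2)]; its true
    size is then below [2 ^- a / 2], and [slice_expand] doubles it. A trial point within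
    [2 ^- (a + 4)] of [inv y] has residual at most [2 ^- (a + 3)] and passes. *)
Let cmx_inv : cmx (named D) (fun o v => inv (named_point D o v)).
Proof.
have s1 := @sized_named _ _ D; have s2 := sized_push s1; have s3 := sized_push s2.
have cT : cmx (push (push (named D))) (fun _ w => trial (nth 0%N w 0)).
  by apply: (cmx_exact s3) => i j; apply: cq_trial.
have cF : cmx (push (push (named D)))
    (fun o w => f (slice W x0 (trial (nth 0%N w 0))) - named_point D o (behead (behead w))).
  apply: (cmx_add s3).
    have cX := cmx_slice s3 cT.
    exact: (cmx_comp cpf s3 cX (fun _ w _ => hU (trial_le (nth 0%N w 0)))).
  by apply: (cmx_opp s3); apply: (cmx_push s2 (cmx_push s1 (cmx_named_point D))).
have [|Q [cQ hQ]] := cmx_approx (N := fun _ w => (nth 0%N w 1 + 3)%N) s3 cF.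
  exact: cf_addn (cf_proj _ _) (cf_const _ _).
pose T : fn bool := fun o w => [forall j, `|Q ord0 j o w| <= 2 ^- (nth 0%N w 1 + 2)].
apply: (cmx_search s1 (T := T) (Q := fun i j _ w => trial (nth 0%N w 0) i j)).
- apply: cb_all => j; apply: cb_ler; first exact: cq_norm.
  by apply: cq_pow2; apply: cf_addn (cf_proj _ _) (cf_const _ _).
- exact: cq_trial.
- move=> o v a hv; have [Dy _] := named_pointP hv; have [ys ye] := hinv Dy.
  have [e he] := trial_dense Dy (pow2_gt0 R (a + 4)).
  exists e; apply/forallP => j /=.
  have := hQ o [:: e, a & v] hv ord0 j; rewrite /= !mxE.
  have := slice_lip hf hW (trial_le e) ys; rewrite ye => h1.
  have := coord_le_norm (f (slice W x0 (trial e)) - named_point D o v) j; rewrite !mxE.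
  move=> h2 h3.
  have := ler_normB (f (slice W x0 (trial e)) ord0 j - named_point D o v ord0 j)
    (f (slice W x0 (trial e)) ord0 j - named_point D o v ord0 j - Q ord0 j o [:: e, a & v]).
  rewrite subKr => /le_trans; apply.
  move: h3 he; rewrite !pow2D; have := pow2_gt0 R a.
  have -> : 2 ^- 4 = 16^-1 :> R by rewrite -natrX.
  have -> : 2 ^- 3 = 8^-1 :> R by rewrite -natrX.
  have -> : 2 ^- 2 = 4^-1 :> R by rewrite -natrX.
  lra.
- move=> o v a e hv hT i j; have [Dy _] := named_pointP hv; have [ys ye] := hinv Dy.
  rewrite (ord1 i) -[X in `|X|]opprB normrN.
  have -> : trial e ord0 j - inv (named_point D o v) ord0 j =
    (trial e - inv (named_point D o v)) ord0 j by rewrite !mxE.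
  apply: le_trans (coord_le_norm _ _) _.
  apply: le_trans (slice_expand hf hW (trial_le e) ys) _; rewrite ye.
  suff : `|f (slice W x0 (trial e)) - named_point D o v| <= 2 ^- a / 2 by lra.
  apply: norm_le => [|l]; first by rewrite divr_ge0 // ltW ?pow2_gt0.
  have := hQ o [:: e, a & v] hv ord0 l; rewrite /= !mxE.
  have /forallP /(_ l) /= := hT.
  set A := f _ _ _ - _; set B := Q _ _ _ _ => h1 h2.
  have := ler_normD (A - B) B; rewrite subrK => /le_trans; apply.
  move: h1 h2; rewrite !pow2D; have := pow2_gt0 R a.
  have -> : 2 ^- 3 = 8^-1 :> R by rewrite -natrX.
  have -> : 2 ^- 2 = 4^-1 :> R by rewrite -natrX.
  lra.
Qed.

Let Dg := section_der Df W x0 inv.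

Let D_open y : D y -> exists2 d, 0 < d & forall z, `|z - y| <= d -> D z.
Proof. exact: eball_norm. Qed.

Let cmx_Dg : cmx (named D) (fun o v => Dg (named_point D o v)).
Proof.
have s1 := @sized_named _ _ D.
have cS := cmx_slice s1 cmx_inv.
have hS o v : named D o v -> U (slice W x0 (inv (named_point D o v))).
  by move=> /named_pointP[/hinv[ys _] _]; apply: hU.
have cJ : cmx (named D) (fun o v => slice_jac Df W x0 (inv (named_point D o v))).
  (* [W *m Df^T] is obtained as the transpose of [Df *m W^T], a product with a rational matrix on
     the right. *)
  have rWT : rational_mx W^T by move=> i j; have [c hc] := rW j i; exists c; rewrite mxE.
  have h := cmx_trmx s1 (cmx_mulmxr s1 rWT (cmx_comp cpDf s1 cS hS)).
  by apply: cmx_ext h _ => o v _; rewrite trmx_mul trmxK.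
have [K K0 hK] := section_der_bound hW hinv.
apply: (cmx_trmx s1); apply: (cmx_inv_mulmx (K := K) s1 rW cJ).
  by move=> o v /named_pointP[/hinv[ys _] _]; apply: (jac_unit hW).
move=> o v /named_pointP[Dy _] i j.
by have := hK _ Dy j i; rewrite /section_der mxE.
Qed.

Lemma computable_section : exists g Dg,
  [/\ computable_on D g, C1_with_derivative D g Dg /\ computable_on D Dg,
      (forall y, D y -> U (g y)), g (f x0) = x0 & forall y, D y -> f (g y) = y].
Proof.
exists (slice W x0 \o inv), Dg; split.
- apply: computable_on_cmx; apply: cmx_slice cmx_inv; exact: sized_named.
- split; last exact: computable_on_cmx cmx_Dg.
  move=> y Dy; have [h1 h2] := section_diff hf hW D_open hinv Dy; split; [exact: h1|exact: h2|].
  apply: (section_der_continuous hf hW D_open hinv _ Dy).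
  by move=> t /hU /C1[].
- by move=> y /hinv[ys _]; apply: hU.
- have Dx : D (f x0).
    rewrite /D /eball /= subrr (_ : enorm 0 = 0) ?pow2_gt0 //.
    by rewrite /enorm big1 ?sqrtr0 // => i _; rewrite mxE expr0n.
  (* 0 is also a preimage of [f x0], so injectivity on the cube forces [inv (f x0) = 0]. *)
  have [h1 h2] := hinv Dx; have h0 : `|0 : 'rV[R]_m| <= 2 ^- k by rewrite normr0 ltW.
  have := slice_expand hf hW h1 h0; rewrite h2 slice0 subrr normr0 mulr0 subr0.
  by rewrite normr_le0 => /eqP /= ->; rewrite slice0.
- by move=> y /hinv[].
Qed.

End LocalSection.

Lemma effective_local_section (R : realType) (n m : nat) (U : set 'rV[R]_n) (f : 'rV[R]_n -> 'rV[R]_m)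
    (Df : 'rV[R]_n -> 'M[R]_(m, n)) (x0 : 'rV[R]_n) :
  re_open U -> computable_on U f -> C1_with_derivative U f Df ->
  computable_on U Df -> U x0 -> computable_vec x0 -> \rank (Df x0) = m ->
  exists delta : rat, 0 < delta /\
    exists (g : 'rV[R]_m -> 'rV[R]_n) (Dg : 'rV[R]_m -> 'M[R]_(n, m)),
      [/\ computable_on (eball (f x0) (ratr delta)) g,
          C1_with_derivative (eball (f x0) (ratr delta)) g Dg /\
            computable_on (eball (f x0) (ratr delta)) Dg,
          (forall y, eball (f x0) (ratr delta) y -> U (g y)),
          g (f x0) = x0 &
          forall y, eball (f x0) (ratr delta) y -> f (g y) = y].
Proof.
move=> [p [hp _]] cpf C1 cpDf Ux0 cpx0 rk.
have [_ _ cDf] := C1 _ Ux0.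
have [c [k hk]] := good_slice (theta_nbhs hp Ux0) cDf rk.
exists (2 ^- k.+1); split; first by rewrite invr_gt0 exprn_gt0.
have -> : ratr (2 ^- k.+1) = 2 ^- k.+1 :> R.
  by rewrite fmorphV rmorphXn /= ratr_nat.
apply: (computable_section cpf C1 cpDf cpx0 (W := qmx R c)).
- exact: rational_qmx.
- by move=> t /hk[].
- by move=> t /hk[].
Qed.

(** * The radius of openness *)

Section OpennessRadius.
Variable R : realType.

Lemma rho_name n (z : 'rV[R]_n) : exists p, rho p z.
Proof.
pose Z k l c := forall j : 'I_n, j = l :> nat -> `|z ord0 j - qdec c| <= 2 ^- k.
have hZ k l : exists c, Z k l c.
  have [lt|le] := ltnP l n; last first.
    by exists 0%N => j e; move: le; rewrite -e leqNgt ltn_ord.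
  have [c hc] := qdec_dense (z ord0 (Ordinal lt)) (pow2_gt0 R k).
  exists c => j e; have -> : j = Ordinal lt by apply: val_inj.
  exact: ltW.
exists (fun x => projT1 (cid (hZ (cunpair x).1 (cunpair (cunpair x).2).2))).
move=> k i j; rewrite (ord1 i).
case: (cid _) => c /= hc; have := hc j; rewrite !cunpair_cpair /=; exact.
Qed.

(* A name of [x] one bit more precise than required: all its entries up to
   precision [N] remain valid for the points at distance at most [2 ^- N.+1]
   from [x]. *)
Definition slack (p : nat -> nat) (a : nat) : nat :=
  p (cpair (cunpair a).1.+1 (cunpair a).2).

(** Follow [slack p] below [N] and any name of [z] from there on. An entry of precision [k] below
    [N] errs by at most [2 ^- k.+1] for [x], and moving to [z] adds at most [2 ^- N], which is no
    larger. *)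
Lemma slack_near n (p : nat -> nat) (x : 'rV[R]_n) N z : rho p x ->
  `|z - x| <= 2 ^- N -> exists q, rho q z /\ agree N (slack p) q.
Proof.
move=> hp hz; have [pz hpz] := rho_name z.
exists (fun a => if (a < N)%N then slack p a else pz a); split; last first.
  by move=> i ->.
move=> k i j; case: ifP => lt; last exact: hpz.
have lk : (k.+1 <= N)%N by apply: leq_ltn_trans (leq_cpair _ _) lt.
rewrite /slack cunpair_cpair /=.
have h1 := hp k.+1 i j.
have h2 : `|z i j - x i j| <= 2 ^- k.+1.
  have := mx_coord_le_norm (z - x) i j; rewrite !mxE => /le_trans; apply.
  apply: le_trans hz _; rewrite lef_pV2 ?qualifE /= ?exprn_gt0 //.
  by rewrite ler_weXn2l // ler1n.
have := ler_normD (z i j - x i j) (x i j - qdec (p (cpair k.+1 (cpair i j)))).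
rewrite addrA subrK => /le_trans; apply.
by move: h1 h2; rewrite pow2_half; lra.
Qed.

Lemma rho_slack n (p : nat -> nat) (x : 'rV[R]_n) : rho p x -> rho (slack p) x.
Proof.
move=> hp k i j; rewrite /slack cunpair_cpair /=.
apply: le_trans (hp k.+1 i j) _; rewrite pow2_half.
have := pow2_gt0 R k; lra.
Qed.

(** The cube has half-side [2 * 2 ^- k] because [slice_onto] covers a ball of half that size. *)
Lemma open_section n m (f : 'rV[R]_n -> 'rV[R]_m) (Df : 'rV[R]_n -> 'M[R]_(m, n))
    (W : 'M[R]_(m, n)) (U : set 'rV[R]_n) x k :
  C1_with_derivative U f Df ->
  (forall t : 'rV[R]_m, `|t| <= 2 * 2 ^- k -> U (slice W x t)) ->
  (forall t : 'rV[R]_m, `|t| <= 2 * 2 ^- k ->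
     forall i j, `|(slice_jac Df W x t - 1%:M) i j| <= (2 * m.+1%:R)^-1) ->
  exists g : 'rV[R]_m -> 'rV[R]_n,
        [/\ forall y, eball (f x) (2 ^- k) y -> U (g y),
            g (f x) = x &
            forall y, eball (f x) (2 ^- k) y -> f (g y) = y].
Proof.
move=> C1 hU hW.
have s0 : 0 < 2 * 2 ^- k :> R by rewrite mulr_gt0 // pow2_gt0.
have hf (t : 'rV[R]_m) : `|t| <= 2 * 2 ^- k -> differentiable f (slice W x t) /\
    forall h : 'rV[R]_n, 'd f (slice W x t) h = (Df (slice W x t) *m h^T)^T.
  by move=> /hU /C1[].
have h y : eball (f x) (2 ^- k) y -> exists2 t : 'rV[R]_m, `|t| <= 2 * 2 ^- k &
    f (slice W x t) = y.
  move=> hy; apply: (slice_onto s0 hf hW).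
  rewrite mulrAC divff ?mul1r ?pnatr_eq0 //; apply: ltW.
  exact: le_lt_trans (norm_le_enorm _) hy.
pose T y := [set t : 'rV[R]_m | `|t| <= 2 * 2 ^- k /\ f (slice W x t) = y].
have hT y : eball (f x) (2 ^- k) y -> T y (xget 0 (T y)).
  by move=> /h[t ts te]; case: xgetP => // /(_ t) /(_ (conj ts te)).
have Ux : U x by rewrite -(slice0 W x); apply: hU; rewrite normr0 ltW.
(* The graph asks no regularity of [g], so the value at the centre can be set separately. *)
exists (fun y => if y == f x then x else slice W x (xget 0 (T y))); split.
- move=> y /hT[ty _]; case: eqP => // _; exact: hU.
- by rewrite eqxx.
- by move=> y /hT[_ ty]; case: eqP => [->|].
Qed.

(** * Certificates for the radius and their search *)

Section Search.
Variables (n m : nat) (X : set 'rV[R]_n).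
Variables (f : 'rV[R]_n -> 'rV[R]_m) (Df : 'rV[R]_n -> 'M[R]_(m, n)).
Hypothesis C1 : C1_with_derivative X f Df.
Variable c : prf.
Hypothesis hc : forall x, X x -> forall p, rho p x ->
  exists q, computes c p q /\ rhoM q (Df x).

Definition left_name (o : nat -> nat) (a : nat) := o a.*2.
Definition right_name (o : nat -> nat) (a : nat) := o a.*2.+1.

Lemma left_pair_name p q : left_name (pair_name p q) = p.
Proof.
by apply/funext => a; rewrite /left_name /pair_name odd_double doubleK.
Qed.

Lemma right_pair_name p q : right_name (pair_name p q) = q.
Proof.
by apply/funext => a; rewrite /right_name /pair_name /= odd_double uphalf_double.
Qed.

Let P : ctx := fun o v => v = [:: 0%N] /\
  exists U x, [/\ theta (left_name o) U, rho (right_name o) x,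
    U x, U `<=` X & \rank (Df x) = m].

(** A candidate consists of the precision at which [Df] is read, an exponent [N] for the
    neighbourhood of [x] of size [2 ^- N], the output [k], the index of a ball listed for [U], and
    the entries of [W]. *)
Let e_prec (w : seq nat) := untuple (nth 0%N w 0) 0.
Let e_dist (w : seq nat) := untuple (nth 0%N w 0) 1.
Let e_out (w : seq nat) := untuple (nth 0%N w 0) 2.
Let e_ball (w : seq nat) := untuple (nth 0%N w 0) 3.
Let e_mx i j : fn R := fun _ w =>
  qdec (untuple (nth 0%N w 0) (4 + cpair (i : 'I_m) (j : 'I_n))).

Let Dval (i : 'I_m) (j : 'I_n) : fn nat := fun o w =>
  run (slack (right_name o)) c [:: cpair (e_prec w) (cpair i j)].
Let Duse (i : 'I_m) (j : 'I_n) : fn nat := fun o w =>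
  run (slack (right_name o)) (query_bound 1 c) [:: cpair (e_prec w) (cpair i j)].

Let xval (i : 'I_n) : fn R := fun o w =>
  qdec (right_name o (cpair (e_dist w) (cpair 0 i))).
Let cval (i : 'I_n) : fn R := fun o w => qdec (left_name o (cpair (e_ball w) i.+1)).
(** A point within [2 ^- N] of [x] in the sup norm is within [2 * 2 ^- N] of the approximation
    [xval], hence within [2 n * 2 ^- N] in the Euclidean norm; the listed radius is reduced by this
    amount. *)
Let rval : fn R := fun o w =>
  qdec (left_name o (cpair (e_ball w) 0)) - (2 * n)%:R * 2 ^- e_dist w.

(** [T1]: the values of [Df] depend only on entries that stay valid within [2 ^- N] of [x]. [T2]:
    this neighbourhood lies in the chosen ball, with squares to avoid roots. [T3]: [W *m Df^T] is
    close to 1 even after the reading error. [T4]: [W] maps the cube of half-side [2 * 2 ^- k] into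
    the neighbourhood. *)
Let T1 : fn bool := fun o w => [forall i, [forall j, (Duse i j o w < e_dist w)%N]].
Let T2 : fn bool := fun o w => (0 < rval o w) &&
  (\sum_i (xval i o w - cval i o w) * (xval i o w - cval i o w) < rval o w * rval o w).
Let T3 : fn bool := fun o w => [forall i : 'I_m, [forall j : 'I_m,
  `|(\sum_l e_mx i l o w * qdec (Dval j l o w)) - (i == j)%:R| +
    2 ^- e_prec w * (\sum_l `|e_mx i l o w|) <= (2 * m.+1)%:R^-1]].
Let T4 : fn bool := fun o w => [forall j,
  2 * 2 ^- e_out w * (\sum_i `|e_mx i j o w|) <= 2 ^- e_dist w].
Let T : fn bool := fun o w => [&& T1 o w, T2 o w, T3 o w & T4 o w].

Let Deval o w a : P o w -> exists r, eval (slack (right_name o)) c [:: a] r.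
Proof.
move=> [_ [U [x [_ hx Ux UX _]]]].
have [q [hq _]] := hc (UX _ Ux) (rho_slack hx).
by exists (q a); apply: hq.
Qed.

Let Ueval o w a : P o w ->
  exists r, eval (slack (right_name o)) (query_bound 1 c) [:: a] r.
Proof.
by move=> /(Deval a)[r /eval_query_bound [u [hu _]]]; exists u.
Qed.

Let sP : sized 1 P. Proof. by move=> o v [->]. Qed.
Let sPP : sized 2 (push P). Proof. exact: sized_push sP. Qed.

Let c_right Q F : cf Q F -> cf Q (fun o w => right_name o (F o w)).
Proof.
move=> hF; apply: cf_oracle; apply: cf_S.
apply: cf_ext (cf_addn hF hF) _ => o v _; exact: addnn.
Qed.

Let c_left Q F : cf Q F -> cf Q (fun o w => left_name o (F o w)).
Proof.
move=> hF; apply: cf_oracle.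
apply: cf_ext (cf_addn hF hF) _ => o v _; exact: addnn.
Qed.

Let c_comp Q i : cf Q (fun _ w => untuple (nth 0%N w 0) i).
Proof. by apply: cf_untuple; apply: cf_proj. Qed.

Let c_slack Q : cf Q (fun o w => slack (right_name o) (head 0%N w)).
Proof.
have h0 : cf Q (fun _ w => head 0%N w) by apply: cf_ext (cf_proj _ 0) _ => o [].
by apply: c_right; apply: cf_cpair; [apply: cf_S; apply: cf_fst|apply: cf_snd].
Qed.

Let c_run d : (forall o w a, P o w -> exists r, eval (slack (right_name o)) d [:: a] r) ->
  forall i j : nat, cf (push P) (fun o w =>
    run (slack (right_name o)) d [:: cpair (e_prec w) (cpair i j)]).
Proof.
move=> hd i j; apply: (cf_run (H := fun o _ => slack (right_name o)) sPP).
- exact: c_slack.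
- by apply: cf_cpair (cf_const _ _); apply: c_comp.
- by move=> o [//|e v] Pv; apply: hd Pv.
Qed.

Let c_T : cb (push P) T.
Proof.
have cN := c_comp (push P) 1.
have cM i j : cq (push P) (e_mx i j) by apply: cq_qdec; apply: c_comp.
apply: cb_and; last apply: cb_and; last apply: cb_and.
- apply: cb_all => i; apply: cb_all => j; apply: cb_leq cN.
  by apply: cf_S; apply: c_run; exact: Ueval.
- have cr : cq (push P) rval.
    apply: cq_subr; last by apply: cq_mul; [apply: cq_natc|apply: cq_pow2].
    by apply: cq_qdec; apply: c_left; apply: cf_cpair (cf_const _ _); apply: c_comp.
  have cd i : cq (push P) (fun o w => xval i o w - cval i o w).
    apply: cq_subr; apply: cq_qdec.
      by apply: c_right; apply: cf_cpair cN (cf_const _ _).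
    by apply: c_left; apply: cf_cpair (cf_const _ _); apply: c_comp.
  apply: cb_and; apply: cb_ltr => //; first exact: (cq_natc _ _ 0).
    by apply: cq_sum => i; apply: cq_mul.
  exact: cq_mul.
- apply: cb_all => i; apply: cb_all => j; apply: cb_ler.
    apply: cq_add.
      apply: cq_norm; apply: cq_subr; last exact: cq_natc.
      apply: cq_sum => l; apply: cq_mul => //; apply: cq_qdec.
      by apply: c_run; exact: Deval.
    apply: cq_mul; first by apply: cq_pow2; apply: c_comp.
    by apply: cq_sum => l; apply: cq_norm.
  have h := cq_inv_succ R (cf_const (push P) (2 * m.+1).-1).
  by apply: cq_ext h _ => o v _; rewrite prednK.
- apply: cb_all => j; apply: cb_ler; last exact: cq_pow2.
  apply: cq_mul; last by apply: cq_sum => i; apply: cq_norm.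
  by apply: cq_mul; [apply: cq_natc|apply: cq_pow2; apply: c_comp].
Qed.

Let D_near o v e U x z i j : P o v ->
  theta (left_name o) U -> rho (right_name o) x -> U x -> U `<=` X -> X z ->
  (Duse i j o (e :: v) < e_dist (e :: v))%N -> `|z - x| <= 2 ^- e_dist (e :: v) ->
  `|Df z i j - qdec (Dval i j o (e :: v))| <= 2 ^- e_prec (e :: v).
Proof.
move=> Pv hU hx Ux UX Xz lt hz.
set a := cpair (e_prec (e :: v)) (cpair i j).
have [r hr] := Deval a Pv; have [u [hu ha]] := eval_query_bound hr.
have [q [hq aq]] := slack_near hx hz.
have [q' [cq' rq']] := hc Xz hq.
have ltu : (u < e_dist (e :: v))%N by move: lt; rewrite /Duse (run_eval hu).
have hqr : eval q c [:: a] r.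
  by apply: ha => l lu; apply: aq; apply: ltn_trans lu ltu.
rewrite /Dval (run_eval hr) (eval_det hqr (cq' a)); exact: rq'.
Qed.

Let sound o v U x e : P o v ->
  theta (left_name o) U -> rho (right_name o) x -> U x -> U `<=` X ->
  T o (e :: v) ->
  exists g : 'rV[R]_m -> 'rV[R]_n,
        [/\ forall y, eball (f x) (2 ^- e_out (e :: v)) y -> U (g y),
            g (f x) = x &
            forall y, eball (f x) (2 ^- e_out (e :: v)) y -> f (g y) = y].
Proof.
move=> Pv hU hx Ux UX; set w := e :: v.
case/and4P => /forallP t1 /andP[r0 t2] /forallP t3 /forallP t4.
have N0 := pow2_gt0 R (e_dist w); set d := 2 ^- e_dist w in N0 *.
(* Membership in [U] is settled before anything else: it places [z] in [X], where the machine for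
   [Df] is correct. *)
have zU (z : 'rV[R]_n) : `|z - x| <= d -> U z.
  move=> hz; rewrite hU; exists (e_ball w) => //; rewrite /eball /=.
  pose a : 'rV[R]_n := \row_i xval i o w.
  set b := name_center _ _.
  have h1 : enorm (a - b) < rval o w.
    rewrite -(@ltr_pXn2r _ 2) ?nnegrE ?enorm_ge0 ?(ltW r0) // enorm_sqr.
    rewrite [X in _ < X]expr2; apply: le_lt_trans t2.
    by apply: ler_sum => i _; rewrite !mxE expr2.
  have h2 : `|x - a| <= d.
    by apply: norm_le => [|i]; [exact: ltW|rewrite !mxE; apply: hx].
  have h3 : enorm (z - a) <= n%:R * (2 * d).
    apply: le_trans (enorm_le _) _; rewrite ler_wpM2l //.
    have := ler_normD (z - x) (x - a); rewrite addrA subrK; lra.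
  have := enorm_triangle (z - a) (a - b); rewrite addrA subrK => /le_lt_trans; apply.
  have -> : qdec (left_name o (cpair (e_ball w) 0)) = rval o w + n%:R * (2 * d) :> R.
    by rewrite /rval -/d natrM; ring.
  by rewrite addrC ltr_leD.
have hs (t : 'rV[R]_m) (W : 'M[R]_(m, n)) : W = \matrix_(i, j) e_mx i j o w ->
    `|t| <= 2 * 2 ^- e_out w -> `|slice W x t - x| <= d.
  move=> eW ht; rewrite /slice addrAC subrr add0r.
  have k0 : 0 < 2 * 2 ^- e_out w :> R by rewrite mulr_gt0 // pow2_gt0.
  apply: le_trans (_ : `|t| * (d / (2 * 2 ^- e_out w)) <= _).
    apply: norm_mulmx; first by rewrite ltW // divr_gt0.
    move=> j; rewrite ler_pdivlMr // mulrC; apply: le_trans (t4 j).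
    by rewrite ler_pM2l //; apply: ler_sum => i _; rewrite eW mxE.
  by rewrite mulrCA ler_piMr ?(ltW N0) // ler_pdivrMr // mul1r.
have C1U : C1_with_derivative U f Df by move=> z /UX /C1.
apply: (open_section (W := \matrix_(i, j) e_mx i j o w) C1U) => t ht.
  by apply: zU; apply: hs ht.
move=> i j; pose z := slice (\matrix_(i, j) e_mx i j o w) x t; have hz : `|z - x| <= d by apply: hs ht.
have Xz : X z by apply: UX; apply: zU.
have /forallP /(_ j) := t3 i.
rewrite natrM; apply: le_trans; rewrite /slice_jac -/z.
(* The first part is the tested rational quantity, the second is bounded by the error term in
   [T3]. *)
have -> : ((\matrix_(i, j) e_mx i j o w) *m (Df z)^T - 1%:M) i j =
  (\sum_l e_mx i l o w * qdec (Dval j l o w) - (i == j)%:R) +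
  \sum_l e_mx i l o w * (Df z j l - qdec (Dval j l o w)).
  rewrite !mxE; under eq_bigr do rewrite !mxE.
  rewrite [RHS]addrAC -big_split /=; congr (_ - _).
  by apply: eq_bigr => l _; ring.
apply: le_trans (ler_normD _ _) _; apply: lerD => //.
rewrite mulr_sumr; apply: le_trans (ler_norm_sum _ _ _) _.
apply: ler_sum => l _; rewrite normrM mulrC ler_wpM2r //.
have /forallP /(_ l) lt := t1 j.
exact: (D_near Pv hU hx Ux UX Xz lt).
Qed.

(** There is no circularity in the choices: [W] comes from the rank, the precision [a] from the size
    of [W], and the query bounds depend only on [a] and the name of [x]. [N] can then exceed these
    bounds and also fit the ball, and [k] is adapted to [W] and [N]. *)
Let complete o v : P o v -> exists e, T o (e :: v).
Proof.
move=> Pv; have [_ [U [x [hU hx Ux UX rk]]]] := Pv.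
have e4 : 0 < (2 * m.+1)%:R^-1 / 4 :> R by rewrite divr_gt0 // invr_gt0 ltr0n.
set ee := (2 * m.+1)%:R^-1 in e4 *.
have [q hq] := rational_right_inverse rk e4; set W := qmx R q in hq.
have [h h0 hh] := scale_lt (total_sum_ge0 W) e4.
have [a ha] := pow2_lt h0.
pose u (i : 'I_m) (j : 'I_n) := run (slack (right_name o)) (query_bound 1 c)
  [:: cpair a (cpair i j)].
pose M := (\sum_i \sum_j u i j)%N.
have uM i j : (u i j <= M)%N.
  rewrite /M (bigD1 i) //= (bigD1 j) //= -addnA; exact: leq_addr.
have [jb _ hjb] : (\bigcup_(j in [set: nat]) eball (name_center (left_name o) j)
    (qdec (left_name o (cpair j 0)))) x by rewrite -hU.
set b := name_center _ _ in hjb; set r := qdec _ in hjb.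
(* The reduced radius costs [2 n * 2 ^- N] and the approximation of [x] another [n * 2 ^- N]; adding
   1 keeps the divisor positive when [n = 0]. *)
have p3 : 0 < (3 * n + 1)%:R :> R by rewrite ltr0n addn1.
have g0 : 0 < (r - enorm (x - b)) / (3 * n + 1)%:R.
  by rewrite divr_gt0 // subr_gt0.
have [N' hN'] := pow2_lt g0.
pose N := (N' + M.+1)%N.
have hN : (3 * n + 1)%:R * 2 ^- N < r - enorm (x - b).
  rewrite mulrC -ltr_pdivlMr //; apply: le_lt_trans hN'.
  rewrite lef_pV2 ?qualifE /= ?exprn_gt0 //.
  by rewrite ler_weXn2l ?ler1n // leq_addr.
have N0 := pow2_gt0 R N; set d := 2 ^- N in N0 hN.
(* [T4] needs the factor [2 \sum |W|]; adding 1 makes it a divisor. *)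
have S1 : 0 < 2 * (\sum_i \sum_j `|W i j|) + 1 :> R.
  by rewrite ltr_wpDl // mulr_ge0 // total_sum_ge0.
have [k hk] := pow2_lt (divr_gt0 N0 S1).
pose F l := match l with 0 => a | 1 => N | 2 => k | 3 => jb
  | l'.+4 => if (insub (cunpair l').1, insub (cunpair l').2) is (Some i, Some j)
      then q i j else 0%N end%N.
have [e he] := untuple_onto F (4 + cpair (m + n) (m + n)).
exists e; set w := e :: v.
have ea : e_prec w = a by rewrite /e_prec /= he.
have eN : e_dist w = N by rewrite /e_dist /= he.
have ek : e_out w = k by rewrite /e_out /= he.
have eb : e_ball w = jb by rewrite /e_ball /= he.
have eW i j : e_mx i j o w = W i j.
  rewrite /e_mx /= he ?ltn_add2l.
    by rewrite /F /= cunpair_cpair /= !valK mxE.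
  by apply: ltn_cpair; apply: leq_trans (ltn_ord _) _; rewrite ?leq_addl ?leq_addr.
have t1 : T1 o w.
  apply/forallP => i; apply/forallP => j.
  by rewrite /Duse ea eN /N -[run _ _ _]/(u i j) addnS ltnS (leq_trans (uM i j)) // leq_addl.
apply/and4P; split => //.
- pose xa : 'rV[R]_n := \row_i xval i o w.
  have hxa : `|xa - x| <= d.
    apply: norm_le => [|i]; first exact: ltW.
    by rewrite !mxE distrC /xval eN; apply: hx.
  have rE : rval o w = r - (2 * n)%:R * d by rewrite /rval eb eN.
  have h1 : enorm (xa - b) < rval o w.
    have := enorm_triangle (xa - x) (x - b); rewrite addrA subrK => /le_lt_trans; apply.
    have h2 : enorm (xa - x) <= n%:R * d.
      by apply: le_trans (enorm_le _) _; rewrite ler_wpM2l.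
    move: hN; rewrite rE natrD !natrM; lra.
  have r0 : 0 < rval o w by apply: le_lt_trans h1; apply: enorm_ge0.
  rewrite /T2 r0 /=.
  have : enorm (xa - b) ^+ 2 < rval o w ^+ 2.
    by rewrite ltr_pXn2r ?nnegrE ?enorm_ge0 ?(ltW r0).
  rewrite enorm_sqr -expr2; apply: le_lt_trans; apply: ler_sum => i _.
  by rewrite !mxE -expr2 /cval eb.
- apply/forallP => i; apply/forallP => j; rewrite ea -/ee.
  have hrow : 2 ^- a * \sum_l `|e_mx i l o w| <= ee / 4.
    under eq_bigr do rewrite eW.
    rewrite mulrC; apply: le_trans hh; apply: ler_pM => //.
    + exact: sum_norm_ge0.
    + exact: row_sum_le.
    + exact: ltW.
  have h2 : `|\sum_l e_mx i l o w * (qdec (Dval j l o w) - Df x j l)| <= ee / 4.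
    apply: le_trans hrow; rewrite mulr_sumr; apply: le_trans (ler_norm_sum _ _ _) _.
    apply: ler_sum => l _; rewrite normrM mulrC ler_wpM2r // distrC.
    have := D_near (e := e) (z := x) (i := j) (j := l) Pv hU hx Ux UX (UX _ Ux).
    rewrite -/w ea; apply; first by have /forallP /(_ j) /forallP := t1; apply.
    by rewrite subrr normr0 ltW // pow2_gt0.
  have h1 := hq i j.
  have eq1 : \sum_l e_mx i l o w * qdec (Dval j l o w) - (i == j)%:R =
    (W *m (Df x)^T - 1%:M) i j +
      \sum_l e_mx i l o w * (qdec (Dval j l o w) - Df x j l).
    rewrite !mxE [RHS]addrAC -big_split /=; congr (_ - _).
    by apply: eq_bigr => l _; rewrite eW [(_^T) _ _]mxE; ring.
  rewrite eq1.
  have := ler_normD ((W *m (Df x)^T - 1%:M) i j)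
    (\sum_l e_mx i l o w * (qdec (Dval j l o w) - Df x j l)).
  by move: h1 h2 hrow e4; lra.
- apply/forallP => j; rewrite ek eN -/d.
  have hS : \sum_i `|e_mx i j o w| <= \sum_i \sum_j `|W i j|.
    apply: ler_sum => i _; rewrite eW (bigD1 j) //= lerDl; exact: sumr_ge0.
  have k0 := pow2_gt0 R k; move: hk; rewrite ltr_pdivlMr // => hk.
  apply: ltW; apply: le_lt_trans hk.
  rewrite -mulrA mulrCA ler_pM2l //; move: hS; lra.
Qed.

Lemma mv_computable_I_graph : mv_computable (I_graph X f Df).
Proof.
have [F [[d hd] hT]] := cf_search sP c_T complete.
have [d' hd'] : cf P (fun o v => untuple (F o v) 2).
  by apply: cf_untuple; exists d.
(* The promised [k'] certifies that the input lies in the domain; the output is the third component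
   of the certificate that was found. *)
exists d' => U x [k' [Ux UX oU rk _]] pU px hU hx.
have Pv : P (pair_name pU px) [:: 0%N].
  by split => //; exists U, x; rewrite left_pair_name right_pair_name.
exists (untuple (F (pair_name pU px) [:: 0%N]) 2); split; first exact: hd'.
split => //; apply: (sound (o := pair_name pU px) (v := [:: 0%N])) (hT _ _ Pv) => //.
  by rewrite left_pair_name.
by rewrite right_pair_name.
Qed.

End Search.
End OpennessRadius.

Unset Implicit Arguments.

Theorem theorem4 (R : realType) :
  (forall (n m : nat) (U : set 'rV[R]_n) (f : 'rV[R]_n -> 'rV[R]_m)
      (Df : 'rV[R]_n -> 'M[R]_(m, n)) (x0 : 'rV[R]_n),
    re_open U ->
    computable_on U f -> C1_with_derivative U f Df -> computable_on U Df ->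
    U x0 -> computable_vec x0 -> \rank (Df x0) = m ->
    exists delta : rat, 0 < delta /\
      exists (g : 'rV[R]_m -> 'rV[R]_n) (Dg : 'rV[R]_m -> 'M[R]_(n, m)),
        [/\ computable_on (eball (f x0) (ratr delta)) g,
            C1_with_derivative (eball (f x0) (ratr delta)) g Dg /\
              computable_on (eball (f x0) (ratr delta)) Dg,
            (forall y, eball (f x0) (ratr delta) y -> U (g y)),
            g (f x0) = x0 &
            forall y, eball (f x0) (ratr delta) y -> f (g y) = y])
  /\
  (forall (n m : nat) (X : set 'rV[R]_n) (f : 'rV[R]_n -> 'rV[R]_m)
      (Df : 'rV[R]_n -> 'M[R]_(m, n)),
    re_open X ->
    computable_on X f -> C1_with_derivative X f Df -> computable_on X Df ->
    mv_computable (I_graph X f Df)).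
Proof.
split; first exact: effective_local_section.
move=> n m X f Df _ _ C1 [c hc]; exact: (mv_computable_I_graph C1 hc).
Qed.
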